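(* Let $C$ be an algebraically closed field of characteristic zero and let $G \subset \mathrm{GL}_2(C)$ be a linear algebraic group. Then there exists a toric envelope $H$ of $G$ such that $H$ is bounded by $6$.
   Context: An algebraic (sub)group of $\mathrm{GL}_n(C)$ is a Zariski-closed subgroup. A torus is a commutative connected algebraic subgroup $T \subset \mathrm{GL}_n(C)$ such that every element of $T$ is diagonalizable. An algebraic group $H \subset \mathrm{GL}_n(C)$ is a toric envelope of an algebraic group $G \subset \mathrm{GL}_n(C)$ if there exists a torus $T \subset \mathrm{GL}_n(C)$ such that $H = T \cdot G = \{tg : t\in T, g \in G\}$ (product as abstract groups; it is not required that $T$ normalizes $G$ or that $G$ normalizes $T$). A closed subvariety $X \subset \mathrm{GL}_n(C)$ is bounded by $d$ if there exist polynomials $f_1,\dots,f_M \in C[x_{11},x_{12},\dots,x_{nn}]$ of degree at most $d$ such that $X = \mathrm{GL}_n(C) \cap \{f_1 = \dots = f_M = 0\}$. *)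

(* Defs.v *)
From mathcomp Require Import all_boot all_order all_algebra.
From mathcomp Require Import boolp classical_sets.
From mathcomp Require Import mpoly.

Set Implicit Arguments.
Unset Strict Implicit.
Unset Printing Implicit Defensive.

Import GRing.Theory.
Local Open Scope classical_set_scope.
Local Open Scope ring_scope.

(* GL_n(C) is the set of invertible matrices in 'M[C]_n, and subsets of GL_n(C)
   are sets of matrices. The n * n variables of the polynomials are the matrix
   entries, listed in the order fixed by mxvec. *)
Definition zero_locus (C : fieldType) (n : nat) (S : set {mpoly C[n * n]}) :
    set 'M[C]_n :=
  [set A | A \in unitmx /\ forall p, S p -> p.@[mxvec A 0] = 0].

Definition zariski_closed (C : fieldType) (n : nat) (X : set 'M[C]_n) : Prop :=
  exists S : set {mpoly C[n * n]}, X = zero_locus S.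

Definition algebraic_group (C : fieldType) (n : nat) (G : set 'M[C]_n) : Prop :=
  [/\ zariski_closed G,
      G 1%:M,
      (forall A B, G A -> G B -> G (A *m B)) &
      (forall A, G A -> G (invmx A))].

Definition zariski_connected (C : fieldType) (n : nat) (X : set 'M[C]_n) : Prop :=
  X !=set0 /\
  forall Y Z : set 'M[C]_n, zariski_closed Y -> zariski_closed Z ->
    X `<=` Y `|` Z -> X `&` (Y `&` Z) = set0 -> X `<=` Y \/ X `<=` Z.

Definition torus (C : fieldType) (n : nat) (T : set 'M[C]_n) : Prop :=
  [/\ algebraic_group T,
      (forall A B, T A -> T B -> A *m B = B *m A),
      zariski_connected T &
      (forall A, T A -> diagonalizable A)].

Definition toric_envelope (C : fieldType) (n : nat) (H G : set 'M[C]_n) : Prop :=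
  algebraic_group H /\
  exists T : set 'M[C]_n, torus T /\ H = [set t *m g | t in T & g in G].

(* msize is the total degree plus one, and 0 for the zero polynomial. *)
Definition bounded_by (C : fieldType) (n d : nat) (X : set 'M[C]_n) : Prop :=
  exists fs : seq {mpoly C[n * n]},
    (forall f, f \in fs -> (msize f <= d.+1)%N) /\
    X = zero_locus [set f | f \in fs].

(* Main.v *)
Require Import Defs.
From mathcomp Require Import all_boot all_order all_algebra all_fingroup.
From mathcomp Require Import boolp classical_sets.
From mathcomp Require Import mpoly.
From mathcomp Require Import ring zify.

Set Implicit Arguments.
Unset Strict Implicit.
Unset Printing Implicit Defensive.

Import GRing.Theory.

(** The envelope is found by looking at the action of [G] on the projective line.

    If [G] fixes a point or preserves a pair of points, then after a change of basis
    it consists of triangular or of monomial matrices. A monomial group becomes,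
    multiplied by the diagonal torus, the diagonal or the full monomial group, which
    are cut out by quadratic equations. A triangular group containing a nonscalar
    matrix with a single eigenvalue becomes the full triangular group, because it
    contains, up to scalars, all unipotent triangular matrices; this rests on the
    independence of exponential polynomials ([exponential_polynomial_independence]).
    Any other triangular group is commutative and contained in a torus.

    Suppose now that [G] is primitive, and let [K] be the group of scalar multiples
    of elements of [G], obtained with the torus of scalars. The matrices satisfying
    all equations of degree at most [d] of [K] form a group [clos d K]
    ([cone_group_clos]). Such a group is everything or finite modulo scalars
    ([clos_primitive_dichotomy]): a unipotent element, or an element whose eigenvalue
    ratio has order larger than [d], forces a one-parameter subgroup, hence all root
    subgroups by primitivity; when neither occurs, the orders of the elements are
    bounded and one polynomial function isolates the scalars.

    If [K] is infinite modulo scalars, it is dense in every degree. Then all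
    commutators of matrices lie in [G] ([commutators_of_full_clos]), and [K] is the
    general linear group. If [K] is finite modulo scalars, counting fixed points gives
    the tetrahedral, octahedral and icosahedral groups ([finite_primitive_orbits]). In
    these three cases [clos 6 K] is [K] itself ([clos6_finite_primitive]): the
    sextic forms in four variables form a space of dimension larger than 60, so that
    [clos 6 K] is finite modulo scalars, and the orbits of size four and six of the first two groups are preserved
    by equations of degree four and six. *)

(** * Polynomial functions of bounded degree *)

Section PolynomialFunctions.
Local Open Scope classical_set_scope.
Local Open Scope ring_scope.

Variables (C : fieldType) (n : nat).
Implicit Types (f g : 'M[C]_n -> C) (A B : 'M[C]_n) (X : set 'M[C]_n).

Definition polyfun d f := exists2 p : {mpoly C[n * n]},
  (msize p <= d.+1)%N & forall A, f A = p.@[mxvec A 0].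

Lemma polyfun_leq d e f : (d <= e)%N -> polyfun d f -> polyfun e f.
Proof. by move=> de [p sp fp]; exists p => //; lia. Qed.

Lemma polyfun_ext d f g : f =1 g -> polyfun d f -> polyfun d g.
Proof. by move=> fg [p sp fp]; exists p => // A; rewrite -fg. Qed.

Lemma polyfun_const c d : polyfun d (fun=> c).
Proof.
exists c%:MP => [|A]; last by rewrite mevalC.
by rewrite msizeC; case: (c == 0).
Qed.

Lemma polyfun_entry i j : polyfun 1 (fun A => A i j).
Proof.
exists ('X_(mxvec_index i j)) => [|A]; last by rewrite mevalXU mxvecE.
by rewrite msizeX mdeg1.
Qed.

Lemma polyfunD d f g :
  polyfun d f -> polyfun d g -> polyfun d (fun A => f A + g A).
Proof.
move=> [p sp fp] [q sq gq]; exists (p + q) => [|A].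
  by apply: leq_trans (msizeD_le _ _) _; rewrite geq_max sp.
by rewrite mevalD fp gq.
Qed.

Lemma polyfunM d e f g :
  polyfun d f -> polyfun e g -> polyfun (d + e) (fun A => f A * g A).
Proof.
move=> [p sp fp] [q sq gq]; exists (p * q) => [|A]; last first.
  by rewrite mevalM fp gq.
have [->|p0] := eqVneq p 0; first by rewrite mul0r msize0.
have [->|q0] := eqVneq q 0; first by rewrite mulr0 msize0.
by rewrite msizeM //; move: (msize p) (msize q) sp sq => a b; lia.
Qed.

Lemma polyfunZ c d f : polyfun d f -> polyfun d (fun A => c * f A).
Proof. by move=> pf; rewrite -[d]add0n; apply: polyfunM => //; apply: polyfun_const. Qed.

Lemma polyfunB d f g :
  polyfun d f -> polyfun d g -> polyfun d (fun A => f A - g A).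
Proof.
move=> pf pg; apply: (@polyfun_ext d (fun A => f A + -1 * g A)).
  by move=> A; rewrite mulN1r.
by apply: polyfunD => //; apply: polyfunZ.
Qed.

Lemma polyfunX k e f : polyfun k f -> polyfun (k * e) (fun A => f A ^+ e).
Proof.
move=> pf; elim: e => [|e IHe]; first exact: polyfun_const.
rewrite mulnS; apply: (@polyfun_ext _ (fun A => f A * f A ^+ e)).
  by move=> A; rewrite exprS.
exact: polyfunM.
Qed.

Lemma polyfun_sum (I : Type) (r : seq I) (P : pred I) d (F : I -> 'M[C]_n -> C) :
  (forall i, P i -> polyfun d (F i)) ->
  polyfun d (fun A => \sum_(i <- r | P i) F i A).
Proof.
move=> pF; elim: r => [|i r IHr].
  by apply: (@polyfun_ext _ (fun=> 0) _ _ (polyfun_const 0 d)) => A; rewrite big_nil.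
apply: (@polyfun_ext _ (fun A => (if P i then F i A else 0) +
                           \sum_(i <- r | P i) F i A)).
  by move=> A; rewrite big_cons; case: ifP; rewrite ?add0r.
apply: polyfunD => //; case Pi: (P i); [exact: pF | exact: polyfun_const].
Qed.

Lemma polyfun_prod (I : Type) (r : seq I) (d : I -> nat) (F : I -> 'M[C]_n -> C) :
  (forall i, polyfun (d i) (F i)) ->
  polyfun (\sum_(i <- r) d i) (fun A => \prod_(i <- r) F i A).
Proof.
move=> pF; elim: r => [|i r IHr].
  apply: (@polyfun_ext _ (fun=> 1) _ _ (polyfun_const 1 _)) => A.
  by rewrite big_nil.
rewrite big_cons; apply: (@polyfun_ext _ (fun A => F i A * \prod_(i <- r) F i A)).
  by move=> A; rewrite big_cons.
exact: polyfunM.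
Qed.

(** Each monomial is homogenized to degree [d] with powers of [delta]. This is what
    makes inverses of matrices, which have the determinant as denominator, accessible
    to polynomial functions. *)
Lemma polyfun_comp_frac d k f (phi : 'M[C]_n -> 'M[C]_n) delta :
  polyfun d f -> (forall i j, polyfun k (fun A => phi A i j)) ->
  polyfun k delta ->
  exists2 F, polyfun (k * d) F &
    forall A, delta A != 0 -> F A = delta A ^+ d * f ((delta A)^-1 *: phi A).
Proof.
move=> [p sp fp] pphi pdelta.
pose mono (m : 'X_{1..n * n}) A :=
  delta A ^+ (d - mdeg m) * \prod_i mxvec (phi A) 0 i ^+ m i.
have dm m : m \in msupp p -> (mdeg m <= d)%N.
  by move=> /msize_mdeg_lt mp; rewrite -ltnS (leq_trans mp).
exists (fun A => \sum_(m <- msupp p | m \in msupp p) p@_m * mono m A) => [|A A0].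
  apply: polyfun_sum => m /dm md; apply: polyfunZ.
  rewrite -{1}(subnK md) mulnDr; apply: polyfunM; first exact: polyfunX.
  rewrite mdegE big_distrr /=.
  apply: polyfun_prod => i; apply: polyfunX.
  case/mxvec_indexP: i => i j; apply: (@polyfun_ext _ (fun A => phi A i j)) => //.
  by move=> A; rewrite mxvecE.
rewrite fp mevalE big_distrr /= [RHS]big_seq; apply: eq_bigr => m /dm md.
rewrite /mono [RHS]mulrCA; congr (_ * _).
rewrite [in RHS](eq_bigr (fun i => (delta A)^-1 ^+ m i * mxvec (phi A) 0 i ^+ m i)).
  rewrite big_split /= prodrXr mulrA -mdegE; congr (_ * _).
  by rewrite exprVn -{2}(subnK md) exprD mulfK // expf_eq0 (negbTE A0) andbF.
by move=> i _; rewrite linearZ mxE exprMn.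
Qed.

Lemma polyfun_comp d k f (phi : 'M[C]_n -> 'M[C]_n) :
  polyfun d f -> (forall i j, polyfun k (fun A => phi A i j)) ->
  polyfun (k * d) (fun A => f (phi A)).
Proof.
move=> pf pphi.
have [F pF FE] := polyfun_comp_frac pf pphi (polyfun_const 1 k).
apply: polyfun_ext pF => A; rewrite FE ?oner_neq0 //.
by rewrite expr1n mul1r invr1 scale1r.
Qed.

Lemma polyfun_mulmx d f A B :
  polyfun d f -> polyfun d (fun M => f (A *m M *m B)).
Proof.
move=> pf; rewrite -[d]mul1n; apply: (polyfun_comp pf) => i j.
apply: (@polyfun_ext _ (fun M => \sum_k (\sum_l A i l * M l k) * B k j)).
  by move=> M; rewrite mxE; apply: eq_bigr => k _; rewrite mxE.
apply: polyfun_sum => k _.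
apply: (@polyfun_ext _ (fun M => B k j * (\sum_l A i l * M l k))).
  by move=> M; rewrite mulrC.
apply: polyfunZ; apply: polyfun_sum => l _; apply: polyfunZ.
exact: polyfun_entry.
Qed.

(** A scaled line is treated as a surface, polynomial in [x] and in [y] separately:
    the powers of a matrix with a single eigenvalue lie on such a surface. *)
Lemma polyfun_scaled_line d f A B : polyfun d f ->
  exists2 q : 'I_d.+1 -> {poly C}, (forall j, (size (q j) <= d.+1)%N) &
    forall x y, f (x *: (A + y *: B)) = \sum_(j < d.+1) x ^+ j * (q j).[y].
Proof.
move=> [p sp fp].
pose lin i : {poly C} := (mxvec A 0 i)%:P + (mxvec B 0 i) *: 'X.
pose mono (m : 'X_{1..n * n}) := \prod_i lin i ^+ m i.
have size_lin i : (size (lin i) <= 2)%N.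
  apply: leq_trans (size_polyD _ _) _; rewrite geq_max.
  apply/andP; split; first exact: leq_trans (size_polyC_leq1 _) _.
  by apply: leq_trans (size_scale_leq _ _) _; rewrite size_polyX.
have size_mono m : (size (mono m) <= (mdeg m).+1)%N.
  rewrite mdegE /mono; elim/big_ind2: _ => [|a u b v Hu Hv|i _].
  - by rewrite size_poly1.
  - by apply: leq_trans (size_polyMleq _ _) _; lia.
  - apply: leq_trans (size_poly_exp_leq _ _) _; rewrite ltnS.
    by have := size_lin i; case: (size _) => [|[|[|]]] //= _; rewrite ?mul0n ?mul1n.
exists (fun j : 'I_d.+1 =>
  \sum_(m <- msupp p | mdeg m == j) p@_m *: mono m) => [j|x y].
  apply: leq_trans (size_sum _ _ _) _.
  apply/bigmax_leqP_seq => m _ /eqP mj.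
  apply: leq_trans (size_scale_leq _ _) _; apply: leq_trans (size_mono m) _.
  by rewrite mj; case: j {mj}.
rewrite fp mevalE.
under [RHS]eq_bigr => j _ do rewrite horner_sum big_distrr /=.
rewrite (exchange_big_dep predT) //= big_seq [RHS]big_seq; apply: eq_bigr => m mp.
have md : (mdeg m < d.+1)%N by rewrite (leq_trans (msize_mdeg_lt mp)).
rewrite (big_pred1 (Ordinal md)) => [|j]; last first.
  by rewrite /= eq_sym -val_eqE.
rewrite hornerZ mulrCA /=; congr (_ * _).
rewrite mdegE -prodrXr horner_prod -big_split /=; apply: eq_bigr => i _.
by rewrite horner_exp !hornerE !linearZ linearD linearZ !mxE /= exprMn [y * _]mulrC.
Qed.

Lemma polyfun_line d f A B : polyfun d f ->
  exists2 q : {poly C}, (size q <= d.+1)%N & forall s, f (A + s *: B) = q.[s].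
Proof.
move=> /(polyfun_scaled_line A B) [q sq fq]; exists (\sum_j q j) => [|s].
  by apply: leq_trans (size_sum _ _ _) _; apply/bigmax_leqP.
rewrite -[_ + _]scale1r fq horner_sum; apply: eq_bigr => j _.
by rewrite expr1n mul1r.
Qed.

End PolynomialFunctions.

(** * Closure by equations of bounded degree *)

Section Closures.
Local Open Scope classical_set_scope.
Local Open Scope ring_scope.

Variables (C : fieldType) (n : nat).
Implicit Types (f g : 'M[C]_n -> C) (A B : 'M[C]_n) (X : set 'M[C]_n).

Definition vanishes f X := forall A, X A -> f A = 0.

Lemma zariski_closedP X : zariski_closed X <->
  (forall A, X A -> A \in unitmx) /\
  (forall A, A \in unitmx -> ~ X A ->
     exists d f, [/\ polyfun d f, vanishes f X & f A != 0]).
Proof.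
split=> [[S ->]|[Xu sepX]].
  split=> [A []//|A Au /not_andP[//|/existsNP[p /not_implyP[Sp /eqP pA]]]].
  exists (msize p), (fun B => p.@[mxvec B 0]); split=> //; first by exists p.
  by move=> B [_]; exact.
exists [set p | forall B, X B -> p.@[mxvec B 0] = 0].
apply/seteqP; split=> A /=.
  by move=> XA; split; [exact: Xu | move=> p; exact].
move=> [Au SA]; apply: contrapT => /(sepX A Au)[d [f [[p _ fp] f0 /eqP[]]]].
by rewrite fp; apply: SA => B /f0; rewrite fp.
Qed.

Lemma zariski_closed_vanish X A : zariski_closed X -> A \in unitmx ->
  (forall d f, polyfun d f -> vanishes f X -> f A = 0) -> X A.
Proof.
move=> /zariski_closedP[_ sepX] Au fA; apply: contrapT => nXA.
by have [d [f [pf f0 /eqP[]]]] := sepX A Au nXA; exact: fA pf f0.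
Qed.

Let monomial_count d := #|{: 'X_{1..(n * n) < d.+1}}|.

Definition poly_of_coefs d (u : 'rV[C]_(monomial_count d)) : {mpoly C[n * n]} :=
  \sum_i u 0 i *: 'X_[bmnm (enum_val i)].

Lemma msize_poly_of_coefs d u : (msize (@poly_of_coefs d u) <= d.+1)%N.
Proof.
apply: leq_trans (msize_sum _ _ _) _; apply/bigmax_leqP => i _.
by apply: leq_trans (msizeZ_le _ _) _; rewrite msizeX; case: (enum_val i).
Qed.

Lemma poly_of_coefsE d u A : (@poly_of_coefs d u).@[mxvec A 0] =
  \sum_i u 0 i * ('X_[bmnm (enum_val i)] : {mpoly C[n * n]}).@[mxvec A 0].
Proof.
rewrite /poly_of_coefs raddf_sum; apply: eq_bigr => i _; exact: mevalZ.
Qed.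

Lemma polyfun_coefs d f : polyfun d f ->
  exists u, forall A, f A = (@poly_of_coefs d u).@[mxvec A 0].
Proof.
move=> [p sp fp]; exists (\row_i p@_(bmnm (enum_val i))) => A.
rewrite fp {1}(mpolywE sp); congr (_.@[_]); rewrite /poly_of_coefs.
rewrite (reindex (fun i : 'I_(monomial_count d) => enum_val i)) /=; last first.
  exact: onW_bij (enum_val_bij _).
by apply: eq_bigr => i _; rewrite mxE.
Qed.

(** The matrix of the values [f i (g j)] is diagonal and invertible, and it factors
    through the space of coefficients of the polynomials of degree at most [d]. *)
Lemma polyfun_separated_bound d : exists M, forall r (f : 'I_r -> 'M[C]_n -> C)
    (g : 'I_r -> 'M[C]_n), (forall i, polyfun d (f i)) ->
  (forall i j, (f i (g j) != 0) = (i == j)) -> (r <= M)%N.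
Proof.
exists (monomial_count d) => r f g pf fg.
have /choice[u fu] i : exists u, forall A, f i A = (@poly_of_coefs d u).@[mxvec A 0].
  exact: polyfun_coefs.
pose U := \matrix_(i < r) u i.
pose V : 'M_(_, r) := \matrix_(k < monomial_count d, j < r)
  ('X_[bmnm (enum_val k)] : {mpoly C[n * n]}).@[mxvec (g j) 0].
have UV : U *m V = diag_mx (\row_i f i (g i)).
  apply/matrixP => i j; rewrite !mxE.
  transitivity (f i (g j)).
    by rewrite fu poly_of_coefsE; apply: eq_bigr => k _; rewrite !mxE.
  by have := fg i j; case: (i =P j) => [<- _|_ /negbFE/eqP ->]; rewrite ?mulr1n ?mulr0n.
have rUV : \rank (U *m V) = r.
  apply/eqP; rewrite -[_ == r]/(row_free _) row_free_unit UV unitmxE det_diag unitfE.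
  by apply/prodf_neq0 => i _; rewrite mxE fg.
by rewrite -rUV; apply: leq_trans (mulmx_max_rank _ _) _.
Qed.

Lemma finite_spanning_seq N (S : set 'rV[C]_N) : exists2 s : seq 'rV[C]_N,
  (forall u, u \in s -> S u) & (forall u, S u -> u \in <<s>>%VS).
Proof.
pose P k := `[< exists2 s : seq 'rV[C]_N, (forall u, u \in s -> S u)
   & \dim <<s>>%VS = k >].
have P0 : exists k, P k.
  by exists 0%N; apply/asboolP; exists [::] => //; rewrite span_nil dimv0.
have Pub k : P k -> (k <= \dim {: 'rV[C]_N})%N.
  by move=> /asboolP[s _ <-]; apply: dimvS; apply: subvf.
have [k /asboolP[s sS sk] kmax] := ex_maxnP P0 Pub.
exists s => // u Su; apply: contraT => us.
have /kmax : P (\dim <<u :: s>>%VS).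
  apply/asboolP; exists (u :: s) => // v; rewrite inE => /orP[/eqP->//|].
  exact: sS.
rewrite -sk => le; case/negP: us.
have sub : (<<s>> <= <<u :: s>>)%VS by rewrite span_cons addvSr.
have /eqP -> : <<s>>%VS == <<u :: s>>%VS.
  by rewrite -(geq_leqif (dimv_leqif_eq sub)).
by rewrite span_cons memvE addvSl.
Qed.

(** Finitely many equations suffice, because the polynomials of degree at most [d]
    that vanish on [X] are spanned by finitely many of them. *)
Lemma bounded_byP d X :
  (forall A, X A -> A \in unitmx) ->
  (forall A, A \in unitmx ->
     (forall f, polyfun d f -> vanishes f X -> f A = 0) -> X A) ->
  bounded_by d X.
Proof.
move=> Xu Xd.
pose S := [set u | vanishes (fun A => (@poly_of_coefs d u).@[mxvec A 0]) X].
have [s sS Ss] := finite_spanning_seq S.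
exists (map (@poly_of_coefs d) s); split.
  by move=> f /mapP[u _ ->]; exact: msize_poly_of_coefs.
apply/seteqP; split=> A /=.
  move=> XA; split=> [|p /mapP[u us ->]]; first exact: Xu.
  exact: (sS _ us).
move=> [Au sA]; apply: Xd => // f /polyfun_coefs[u fu] f0.
have Su : S u by move=> B /f0; rewrite fu.
rewrite fu (coord_span (X := in_tuple s) (Ss u Su)) poly_of_coefsE.
under eq_bigr => i _ do rewrite summxE big_distrl /=.
rewrite exchange_big big1 //= => i _.
have /= := sA (poly_of_coefs s`_i) (map_f _ (mem_nth _ (ltn_ord i))).
rewrite poly_of_coefsE => s0.
under eq_bigr => j _ do rewrite mxE -mulrA.
by rewrite -big_distrr /= s0 mulr0.
Qed.

(** The Zariski closure of [X] as seen by the equations of degree at most [d]. *)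
Definition clos d X : set 'M[C]_n := [set A | A \in unitmx /\
  forall f, polyfun d f -> vanishes f X -> f A = 0].

Lemma clos_unit d X A : clos d X A -> A \in unitmx.
Proof. by case. Qed.

Lemma sub_clos d X A : (forall A, X A -> A \in unitmx) -> X A -> clos d X A.
Proof. by move=> Xu XA; split=> [|f _]; [exact: Xu | exact]. Qed.

Lemma vanishes_clos d f X : polyfun d f -> vanishes f X -> vanishes f (clos d X).
Proof. by move=> pf f0 A [_]; exact. Qed.

Lemma clos_idem d X A : clos d (clos d X) A -> clos d X A.
Proof.
by move=> [Au fA]; split=> // f pf f0; apply: fA => //; exact: vanishes_clos.
Qed.

Lemma clos_bounded d X : bounded_by d (clos d X).
Proof.
apply: bounded_byP => [A []//|A Au fA]; split=> // f pf f0.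
by apply: fA => //; exact: vanishes_clos.
Qed.

Lemma poly_eq0_of_roots (p : {poly C}) (x : nat -> C) N :
  (forall i j, (i < j < N)%N -> x i != x j) -> (size p <= N)%N ->
  (forall i, (i < N)%N -> p.[x i] = 0) -> p = 0.
Proof.
move=> xinj sp px; apply/eqP; apply: contraTT sp => p0; rewrite -ltnNge.
have := max_poly_roots p0 (rs := [seq x i | i <- iota 0 N]).
rewrite size_map size_iota; apply.
  by apply/allP => y /mapP[i]; rewrite mem_iota => /px pxi ->; apply/rootP.
rewrite map_inj_in_uniq ?iota_uniq // => i j; rewrite !mem_iota /= !add0n => iN jN xij.
case: (ltngtP i j) => // ij; have := xinj _ _; last by move=> /(_ j i); rewrite ij iN xij eqxx => /(_ isT).
by move=> /(_ i j); rewrite ij jN xij eqxx => /(_ isT).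
Qed.

(** On a line, a polynomial function of degree [d] is a univariate polynomial with
    [d + 1] coefficients. A subgroup lying on a line is thus recovered from finitely
    many of its elements. *)
Lemma clos_line d X A B (x : nat -> C) s :
  (forall i j, (i < j < d.+1)%N -> x i != x j) ->
  (forall i, (i < d.+1)%N -> X (A + x i *: B)) ->
  A + s *: B \in unitmx -> clos d X (A + s *: B).
Proof.
move=> xinj Xx u; split=> // f pf f0.
have [q sq fq] := polyfun_line A B pf.
rewrite fq (poly_eq0_of_roots xinj sq) ?horner0 // => i /Xx/f0.
by rewrite fq.
Qed.

End Closures.

(** * Matrices of size two acting on the projective line *)

Section ProjectiveLine.
Local Open Scope ring_scope.

Variable C : fieldType.
Implicit Types (A B P : 'M[C]_2) (v w : C * C) (p q : option C).

Definition mx2 (a b c d : C) : 'M[C]_2 :=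
  \matrix_(i, j) if i == 0 then (if j == 0 then a else b)
                 else (if j == 0 then c else d).

Lemma mx2E A : A = mx2 (A 0 0) (A 0 1) (A 1 0) (A 1 1).
Proof.
by apply/matrixP=> [[[|[|i]] ?]] [[|[|j]] ?] //; rewrite mxE /=;
  congr (A _ _); apply: val_inj.
Qed.

Lemma mx2P A : exists a b c d, A = mx2 a b c d.
Proof. by exists (A 0 0), (A 0 1), (A 1 0), (A 1 1); exact: mx2E. Qed.

Lemma eq_mx2 A B : A 0 0 = B 0 0 -> A 0 1 = B 0 1 -> A 1 0 = B 1 0 ->
  A 1 1 = B 1 1 -> A = B.
Proof. by rewrite {5}(mx2E A) {5}(mx2E B) => -> -> -> ->. Qed.

Lemma mx2_inj a b c d a' b' c' d' :
  mx2 a b c d = mx2 a' b' c' d' -> [/\ a = a', b = b', c = c' & d = d'].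
Proof.
by move=> /matrixP E; split; [have := E 0 0|have := E 0 1|have := E 1 0|have := E 1 1];
  rewrite !mxE.
Qed.

Lemma mx2M a b c d a' b' c' d' : mx2 a b c d *m mx2 a' b' c' d' =
  mx2 (a * a' + b * c') (a * b' + b * d') (c * a' + d * c') (c * b' + d * d').
Proof. by apply: eq_mx2; rewrite !mxE !big_ord_recl big_ord0 !mxE /= addr0. Qed.

Lemma mx2Z x a b c d : x *: mx2 a b c d = mx2 (x * a) (x * b) (x * c) (x * d).
Proof. by apply: eq_mx2; rewrite !mxE. Qed.

Lemma mx2D a b c d a' b' c' d' : mx2 a b c d + mx2 a' b' c' d' =
  mx2 (a + a') (b + b') (c + c') (d + d').
Proof. by apply: eq_mx2; rewrite !mxE. Qed.

Lemma scalar_mx2 x : x%:M = mx2 x 0 0 x.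
Proof. by apply: eq_mx2; rewrite !mxE. Qed.

Lemma det_mx2 a b c d : \det (mx2 a b c d) = a * d - b * c.
Proof.
rewrite (expand_det_row _ 0) !big_ord_recl big_ord0 addr0 /cofactor !det_mx11 !mxE /=.
by rewrite expr0 expr1 mul1r mulN1r mulrN.
Qed.

Lemma unit_mx2 a b c d : (mx2 a b c d \in unitmx) = (a * d - b * c != 0).
Proof. by rewrite unitmxE unitfE det_mx2. Qed.

Lemma adj_mx2 a b c d : \adj (mx2 a b c d) = mx2 d (- b) (- c) a.
Proof.
by apply: eq_mx2; rewrite !mxE /cofactor det_mx11 !mxE /= ?expr0 ?expr1 ?sqrrN ?expr1n
  ?mul1r ?mulN1r ?mulr1 //= addn1 sqrrN expr1n mul1r.
Qed.

Lemma invmx_mx2 a b c d : a * d - b * c != 0 ->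
  invmx (mx2 a b c d) = (a * d - b * c)^-1 *: mx2 d (- b) (- c) a.
Proof. by move=> u; rewrite /invmx unit_mx2 u det_mx2 adj_mx2. Qed.

(** The projective line is [option C], with [None] the point at infinity; a point is
    represented by a normalized vector on the corresponding line of the plane. *)
Definition vec_of_pt p : C * C := if p is Some t then (t, 1) else (1, 0).
Definition pt_of_vec v : option C := if v.2 == 0 then None else Some (v.1 / v.2).
Definition wedge v w : C := v.1 * w.2 - v.2 * w.1.
Definition mulv A v : C * C :=
  (A 0 0 * v.1 + A 0 1 * v.2, A 1 0 * v.1 + A 1 1 * v.2).
Definition mobius A p : option C := pt_of_vec (mulv A (vec_of_pt p)).

Lemma vec_of_pt_neq0 p : vec_of_pt p != (0, 0).
Proof. by case: p => [t|]; rewrite xpair_eqE /= oner_eq0 ?andbF. Qed.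

Lemma vec_of_ptK p : pt_of_vec (vec_of_pt p) = p.
Proof. by case: p => [t|]; rewrite /pt_of_vec /= ?oner_eq0 ?eqxx ?divr1. Qed.

Lemma pt_of_vec_eq v w : v != (0, 0) -> w != (0, 0) ->
  (pt_of_vec v == pt_of_vec w) = (wedge v w == 0).
Proof.
case: v w => [x y] [z t]; rewrite /pt_of_vec /wedge !xpair_eqE /=.
have [->|y0] := eqVneq y 0; have [->|t0] := eqVneq t 0;
  rewrite ?andbT ?andbF ?mulr0 ?mul0r ?subrr ?eqxx ?subr0 ?sub0r ?oppr_eq0 ?mulf_eq0.
- by [].
- by move=> /negbTE-> _; rewrite (negbTE t0).
- by move=> _ /negbTE->; rewrite (negbTE y0).
move=> _ _; rewrite (inj_eq (@Some_inj _)) eqr_div // subr_eq0 [y * z]mulrC.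
by [].
Qed.

Lemma det_mulv A v w : wedge (mulv A v) (mulv A w) = \det A * wedge v w.
Proof. by rewrite {3}(mx2E A) det_mx2 /wedge /mulv /=; ring. Qed.

Lemma mulv_neq0 A v : A \in unitmx -> v != (0, 0) -> mulv A v != (0, 0).
Proof.
rewrite unitmxE unitfE => Au; apply: contraNneq => Av.
have wv w : wedge v w = 0.
  by apply: (mulfI Au); rewrite -det_mulv Av mulr0 /wedge /= !mul0r subrr.
have := wv (1, 0); have := wv (0, 1); rewrite /wedge /= !mulr0 !mulr1 subr0 sub0r.
by move=> v1 /eqP; rewrite oppr_eq0 => /eqP v2; rewrite [v]surjective_pairing v1 v2.
Qed.

Lemma mobius_eq A p q : A \in unitmx ->
  (mobius A p == q) = (wedge (mulv A (vec_of_pt p)) (vec_of_pt q) == 0).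
Proof.
move=> Au; rewrite -{1}[q]vec_of_ptK pt_of_vec_eq ?vec_of_pt_neq0 //.
by rewrite mulv_neq0 ?vec_of_pt_neq0.
Qed.

Lemma mulvM A B v : mulv (A *m B) v = mulv A (mulv B v).
Proof.
rewrite (mx2E A) (mx2E B) mx2M /mulv !mxE /=.
by congr pair; ring.
Qed.

Lemma vec_of_ptE v : v != (0, 0) -> exists2 k, k != 0 &
  vec_of_pt (pt_of_vec v) = (k * v.1, k * v.2).
Proof.
case: v => x y; rewrite /pt_of_vec xpair_eqE /=; have [->|y0] := eqVneq y 0.
  by rewrite andbT => x0; exists x^-1; rewrite ?invr_eq0 // mulVf // mulr0.
by move=> _; exists y^-1; rewrite ?invr_eq0 //= mulVf // mulrC.
Qed.

Lemma mobiusM A B p : A \in unitmx -> B \in unitmx -> mobius (A *m B) p = mobius A (mobius B p).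
Proof.
move=> Au Bu; apply/eqP; rewrite eq_sym mobius_eq //.
have Bp0 := mulv_neq0 Bu (vec_of_pt_neq0 p).
have [k k0 kE] := vec_of_ptE Bp0; rewrite {1}/mobius kE.
have ABp0 : mulv (A *m B) (vec_of_pt p) != (0, 0).
  by rewrite mulvM mulv_neq0.
have [l l0] := vec_of_ptE ABp0; rewrite -/(mobius _ _) => ->.
by rewrite !mulvM /wedge /mulv /=; apply/eqP; ring.
Qed.

Lemma mobius1 p : mobius 1%:M p = p.
Proof.
rewrite -{2}[p]vec_of_ptK /mobius /mulv !mxE /= !mul1r !mul0r addr0 add0r.
by rewrite -surjective_pairing.
Qed.

Lemma mobiusZ k A p : k != 0 -> mobius (k *: A) p = mobius A p.
Proof.
move=> k0; rewrite /mobius /pt_of_vec /mulv !mxE /= -!mulrA -!mulrDr mulf_eq0 (negbTE k0) /=.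
by case: eqP => // _; congr Some; rewrite -mulf_div divff // mul1r.
Qed.

Lemma mobiusK A p : A \in unitmx -> mobius (invmx A) (mobius A p) = p.
Proof. by move=> Au; rewrite -mobiusM ?unitmx_inv // mulVmx // mobius1. Qed.

Lemma mobiusVK A p : A \in unitmx -> mobius A (mobius (invmx A) p) = p.
Proof. by move=> Au; rewrite -mobiusM ?unitmx_inv // mulmxV // mobius1. Qed.

Lemma mobius_inj A : A \in unitmx -> injective (mobius A).
Proof. by move=> Au; apply: can_inj (fun p => mobiusK p Au). Qed.

Lemma mobius_None_None A : A \in unitmx -> (mobius A None == None) = (A 1 0 == 0).
Proof.
by move=> Au; rewrite mobius_eq // /wedge /mulv /= !mulr0 !mulr1 sub0r oppr_eq0 addr0.
Qed.

Lemma mobius_None_Some0 A : A \in unitmx -> (mobius A None == Some 0) = (A 0 0 == 0).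
Proof.
by move=> Au; rewrite mobius_eq // /wedge /mulv /= !mulr0 !mulr1 !addr0 subr0.
Qed.

Lemma mobius_Some0_None A : A \in unitmx -> (mobius A (Some 0) == None) = (A 1 1 == 0).
Proof.
by move=> Au; rewrite mobius_eq // /wedge /mulv /= !mulr0 !mulr1 !add0r oppr_eq0.
Qed.

Lemma mobius_Some0_Some0 A : A \in unitmx -> (mobius A (Some 0) == Some 0) = (A 0 1 == 0).
Proof.
by move=> Au; rewrite mobius_eq // /wedge /mulv /= !mulr0 !mulr1 !add0r subr0.
Qed.

Definition basis_mx p q : 'M[C]_2 :=
  mx2 (vec_of_pt p).1 (vec_of_pt q).1 (vec_of_pt p).2 (vec_of_pt q).2.

Lemma basis_mx_unit p q : p != q -> basis_mx p q \in unitmx.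
Proof.
rewrite unit_mx2; apply: contraNneq => pq0.
rewrite -[p]vec_of_ptK -[q]vec_of_ptK pt_of_vec_eq ?vec_of_pt_neq0 // /wedge.
by rewrite [_.2 * _]mulrC pq0.
Qed.

Lemma mobius_basis_None p q : mobius (basis_mx p q) None = p.
Proof.
by rewrite /mobius /mulv !mxE /= !mulr1 !mulr0 !addr0 -surjective_pairing vec_of_ptK.
Qed.

Lemma mobius_basis_Some0 p q : mobius (basis_mx p q) (Some 0) = q.
Proof.
by rewrite /mobius /mulv !mxE /= !mulr1 !mulr0 !add0r -surjective_pairing vec_of_ptK.
Qed.

End ProjectiveLine.

(** * Matrix groups containing the scalars *)

Section MatrixGroups.
Local Open Scope classical_set_scope.
Local Open Scope ring_scope.

Variables (C : closedFieldType) (charC : [pchar C] =i pred0).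
Implicit Types (A B P : 'M[C]_2) (K : set 'M[C]_2) (p q : option C).

Lemma natr_inj_char0 (i j : nat) : (i%:R == j%:R :> C) = (i == j).
Proof.
wlog le_ij : i j / (i <= j)%N.
  by move=> W; case: (leqP i j) => [/W//|/ltnW/W]; rewrite eq_sym [RHS]eq_sym.
rewrite -(subnK le_ij) natrD -subr_eq0 opprD addrCA subrr addr0 oppr_eq0.
rewrite ((pcharf0P C).1 charC); apply/eqP/eqP; lia.
Qed.

Lemma exists_sqrt (x : C) : exists r, r ^+ 2 = x.
Proof.
have [r rE] := @GRing.solve_monicpoly C 2 (fun i => if i == 0%N then x else 0) isT.
by exists r; rewrite rE !big_ord_recl big_ord0 /= mulr1 mul0r !addr0.
Qed.

Lemma exists_quadratic_root (a b c : C) : a != 0 -> c != 0 ->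
  exists2 x, x != 0 & a * x ^+ 2 + b * x + c = 0.
Proof.
move=> a0 c0.
have [x] := @GRing.solve_monicpoly C 2 (fun i => if i == 0%N then - c / a else - b / a) isT.
rewrite !big_ord_recl big_ord0 /= addr0 expr0 mulr1 expr1 => xE.
have x_root : a * x ^+ 2 + b * x + c = 0 by rewrite xE; field.
exists x => //; apply: contraNneq c0 => x0.
by move: x_root; rewrite x0 expr0n mulr0 mulr0 !add0r => ->.
Qed.

Definition matrix_group K := [/\ forall A, K A -> A \in unitmx, K 1%:M,
  forall A B, K A -> K B -> K (A *m B) & forall A, K A -> K (invmx A)].

(** The preimages of the subgroups of the projective linear group. *)
Definition cone_group K := matrix_group K /\ forall c, c != 0 -> K c%:M.

Definition clos_stable d K := forall A, clos d K A -> K A.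

Definition conj_set P K : set 'M[C]_2 := [set A | K (P *m A *m invmx P)].

(** The groups that are not primitive are, up to a change of basis, triangular (one
    invariant point) or monomial (two points). *)
Definition primitive K := forall O : seq (option C), O != [::] -> (size O <= 2)%N ->
  exists A p, [/\ K A, p \in O & mobius A p \notin O].

Lemma conj_mulmx P A B : P \in unitmx ->
  P *m (A *m B) *m invmx P = (P *m A *m invmx P) *m (P *m B *m invmx P).
Proof. by move=> Pu; rewrite !mulmxA mulmxKV. Qed.

Lemma conj_invmx P A : P \in unitmx -> A \in unitmx ->
  P *m invmx A *m invmx P = invmx (P *m A *m invmx P).
Proof.
move=> Pu Au; have PAu : P *m A *m invmx P \in unitmx.
  by rewrite !unitmx_mul Pu Au unitmx_inv.
apply: (can_inj (mulmxK PAu)); rewrite mulVmx // -conj_mulmx // mulVmx //.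
by rewrite mulmx1 mulmxV.
Qed.

Lemma conj_unitmx P A : P \in unitmx -> (P *m A *m invmx P \in unitmx) = (A \in unitmx).
Proof. by move=> Pu; rewrite !unitmx_mul Pu unitmx_inv Pu andbT. Qed.

Lemma conj_scalar_mx P c : P \in unitmx -> P *m c%:M *m invmx P = c%:M.
Proof. by move=> Pu; rewrite scalar_mxC -mulmxA mulmxV // mulmx1. Qed.

Lemma conj_mulmxK P A : P \in unitmx -> P *m (invmx P *m A *m P) *m invmx P = A.
Proof. by move=> Pu; rewrite !mulmxA mulmxV // mul1mx mulmxK. Qed.

Lemma conj_mulmxVK P A : P \in unitmx -> invmx P *m (P *m A *m invmx P) *m P = A.
Proof. by move=> Pu; rewrite !mulmxA mulVmx // mul1mx mulmxKV. Qed.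

Lemma matrix_group_conj P K : P \in unitmx -> matrix_group K ->
  matrix_group (conj_set P K).
Proof.
move=> Pu [Ku K1 KM KV]; split=> [A /Ku||A B|A].
- by rewrite conj_unitmx.
- by rewrite /conj_set /= conj_scalar_mx.
- by rewrite /conj_set /= conj_mulmx //; exact: KM.
- move=> KA; have Au : A \in unitmx by rewrite -(conj_unitmx _ Pu); exact: Ku.
  by rewrite /conj_set /= conj_invmx //; exact: KV.
Qed.

Lemma cone_group_conj P K : P \in unitmx -> cone_group K ->
  cone_group (conj_set P K).
Proof.
move=> Pu [gK cK]; split; first exact: matrix_group_conj.
by move=> c c0; rewrite /conj_set /= conj_scalar_mx //; exact: cK.
Qed.

Lemma clos_stable_conj P d K : P \in unitmx -> clos_stable d K ->
  clos_stable d (conj_set P K).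
Proof.
move=> Pu clK A [Au fA]; apply: clK; split=> [|f pf f0].
  by rewrite conj_unitmx.
by apply: (fA (fun A => f (P *m A *m invmx P))) => [|B /f0//]; exact: polyfun_mulmx.
Qed.

Lemma mobius_conj P A p : P \in unitmx -> A \in unitmx ->
  mobius (invmx P *m A *m P) p = mobius (invmx P) (mobius A (mobius P p)).
Proof. by move=> Pu Au; rewrite !mobiusM ?unitmx_mul ?unitmx_inv ?Pu. Qed.

Lemma primitive_conj P K : P \in unitmx -> matrix_group K -> primitive K ->
  primitive (conj_set P K).
Proof.
move=> Pu [Ku _ _ _] prK O O0 sO.
have [||A [_ [KA /mapP[p pO ->] ApO]]] := prK (map (mobius P) O).
- by move: O0; case: (O).
- by rewrite size_map.
exists (invmx P *m A *m P), p; split=> //; first by rewrite /conj_set /= conj_mulmxK.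
have Au := Ku _ KA; rewrite mobius_conj //; apply: contra ApO => ApO.
by apply/mapP; exists (mobius (invmx P) (mobius A (mobius P p))) => //; rewrite mobiusVK.
Qed.

Lemma conj_set_full P K : P \in unitmx ->
  (forall A, A \in unitmx -> conj_set P K A) -> forall A, A \in unitmx -> K A.
Proof.
move=> Pu fullK A Au; rewrite -(conj_mulmxK A Pu); apply: fullK.
by rewrite !unitmx_mul unitmx_inv Pu Au.
Qed.

Lemma cone_groupZ K c A : cone_group K -> c != 0 -> K A -> K (c *: A).
Proof. by move=> [[_ _ KM _] cK] c0 KA; rewrite -mul_scalar_mx; apply: KM => //; exact: cK. Qed.

Lemma cone_groupZK K c A : cone_group K -> c != 0 -> K (c *: A) -> K A.
Proof.
move=> gK c0 KcA; rewrite -[A](scalerK c0).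
by apply: cone_groupZ => //; rewrite invr_eq0.
Qed.

(** Elementary matrices and scalars generate the general linear group, since
    every element of it is a scalar multiple of one of determinant one. *)
Lemma full_of_elementary K : cone_group K ->
  (forall s, K (mx2 1 s 0 1)) -> (forall s, K (mx2 1 0 s 1)) ->
  forall A, A \in unitmx -> K A.
Proof.
move=> gK KU KL; have [[_ _ KM _] cK] := gK.
have SL a b c d : c != 0 -> a * d - b * c = 1 -> K (mx2 a b c d).
  move=> c0 det1.
  have -> : mx2 a b c d = mx2 1 ((a - 1) / c) 0 1 *m mx2 1 0 c 1 *m
              mx2 1 ((d - 1) / c) 0 1.
    have -> : b = (a * d - 1) / c by rewrite -det1; field.
    by rewrite !mx2M; congr mx2; field.
  by apply: (KM _ _ (KM _ _ _ _) _).
have SL' a b c d : a * d - b * c = 1 -> K (mx2 a b c d).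
  move=> det1; have [c0|] := eqVneq c 0; last by move/SL; apply.
  have a0 : a != 0.
    by apply: contra_eq_neq det1 => ->; rewrite c0 mul0r mulr0 subrr eq_sym oner_eq0.
  have -> : mx2 a b c d = mx2 1 0 (-1) 1 *m mx2 a b (a + c) (b + d).
    by rewrite mx2M; congr mx2; ring.
  by apply: KM => //; apply: SL; [rewrite c0 addr0 | rewrite -det1; ring].
move=> A; have [a [b [c [d ->]]]] := mx2P A; rewrite unit_mx2 => det0.
have [r rE] := exists_sqrt (a * d - b * c).
have r0 : r != 0 by apply: contraNneq det0 => r0; rewrite -rE r0 expr0n.
have -> : mx2 a b c d = r *: mx2 (a / r) (b / r) (c / r) (d / r).
  by rewrite mx2Z ![r * (_ / r)]mulrC !divfK.
apply: cone_groupZ => //; apply: SL'.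
rewrite (_ : _ - _ = (a * d - b * c) / r ^+ 2); last by field.
by rewrite rE divff.
Qed.

Lemma unipotent_line K d b : cone_group K -> clos_stable d K -> b != 0 ->
  K (mx2 1 b 0 1) -> forall s, K (mx2 1 s 0 1).
Proof.
move=> [[_ K1 KM _] _] clK b0 Kb s.
have Kn (i : nat) : K (mx2 1 (i%:R * b) 0 1).
  elim: i => [|i IHi]; first by move: K1; rewrite scalar_mx2 mul0r.
  have -> : mx2 1 (i.+1%:R * b) 0 1 = mx2 1 (i%:R * b) 0 1 *m mx2 1 b 0 1.
    by rewrite mx2M -natr1; congr mx2; ring.
  exact: KM.
have lineE x : 1%:M + x *: mx2 0 b 0 0 = mx2 1 (x * b) 0 1.
  by rewrite scalar_mx2 mx2Z mx2D; congr mx2; ring.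
rewrite -[s](divfK b0) -lineE; apply: clK.
apply: (@clos_line _ _ _ _ _ _ (fun i => i%:R)) => [i j /andP[ij _]|i _|].
- by rewrite natr_inj_char0 neq_ltn ij.
- by rewrite lineE.
- by rewrite lineE unit_mx2 !mulr1 mulr0 subr0 oner_eq0.
Qed.

(** One unipotent element gives a full root subgroup; an element moving its fixed
    point gives, after correction by that root subgroup, a matrix exchanging the
    two coordinate axes, hence the opposite root subgroup. *)
Lemma primitive_unipotent_full K d P a b : cone_group K -> clos_stable d K ->
  primitive K -> P \in unitmx -> b != 0 -> K (P *m mx2 a b 0 a *m invmx P) ->
  forall A, A \in unitmx -> K A.
Proof.
move=> gK clK prK Pu b0 KA; apply: (conj_set_full Pu).
have {clK} clK := clos_stable_conj Pu clK.
have {prK} prK : primitive (conj_set P K) by apply: primitive_conj => //; case: gK.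
have {gK} gK := cone_group_conj Pu gK.
have {}KA : conj_set P K (mx2 a b 0 a) by [].
move: (conj_set P K) clK prK gK KA => {Pu} {}K clK prK gK KA.
have [[Ku _ KM KV] _] := gK.
have a0 : a != 0.
  by have := Ku _ KA; rewrite unit_mx2 mulr0 subr0 mulf_eq0 orbb.
have KU : forall s, K (mx2 1 s 0 1).
  apply: (unipotent_line (b := b / a) gK clK); first by rewrite mulf_neq0 ?invr_eq0.
  apply: (cone_groupZK gK a0); rewrite mx2Z.
  by rewrite mulr1 mulr0 mulrC divfK.
have [h [p [Kh]]] := prK [:: None] isT isT.
rewrite inE => /eqP ->; rewrite inE mobius_None_None ?Ku //.
have [x [y [z [w hE]]]] := mx2P h; rewrite {1}hE mxE /= => z0.
pose y' := y - x * w / z.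
have Kw : K (mx2 0 y' z 0).
  have -> : mx2 0 y' z 0 = mx2 1 (- x / z) 0 1 *m h *m mx2 1 (- w / z) 0 1.
    by rewrite hE !mx2M /y'; congr mx2; field.
  by apply: (KM _ _ (KM _ _ _ _) _).
have y0 : y' != 0.
  by have := Ku _ Kw; rewrite unit_mx2 mul0r sub0r oppr_eq0 mulf_eq0 negb_or => /andP[].
apply: full_of_elementary => // s.
have -> : mx2 1 0 s 1 = mx2 0 y' z 0 *m mx2 1 (s * y' / z) 0 1 *m invmx (mx2 0 y' z 0).
  rewrite invmx_mx2; last by rewrite mul0r sub0r oppr_eq0 mulf_neq0.
  rewrite mx2Z !mx2M; congr mx2; field; by rewrite ?andbT oppr_eq0 mulf_neq0.
by apply: (KM); [exact: KM | exact: KV].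
Qed.

Lemma triangular_form A : exists P a b d,
  P \in unitmx /\ A = P *m mx2 a b 0 d *m invmx P.
Proof.
have [a [b [c [d ->]]]] := mx2P A.
have [c0|c0] := eqVneq c 0.
  exists 1%:M, a, b, d; rewrite unitmx1 c0 mul1mx; split=> //.
  by rewrite -[LHS](mulmxK (unitmx1 _ _)) mulmx1.
have [x] := @GRing.solve_monicpoly C 2 (fun i => if i == 0%N then b / c else (a - d) / c) isT.
rewrite !big_ord_recl big_ord0 /= addr0 expr0 mulr1 expr1 => xE.
have Pu : mx2 x 1 1 0 \in unitmx by rewrite unit_mx2 mulr0 sub0r mulr1 oppr_eq0 oner_eq0.
exists (mx2 x 1 1 0), (c * x + d), c, (a - c * x); split=> //.
apply: (can_inj (mulmxK Pu)); rewrite mulmxKV // !mx2M; congr mx2; try ring.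
rewrite (_ : x * _ + _ = c * x ^+ 2 + d * x); last by ring.
by rewrite xE; field.
Qed.

Lemma nonscalar_normal_form A : ~~ is_scalar_mx A -> exists2 P, P \in unitmx &
  (exists a b, a != b /\ A = P *m mx2 a 0 0 b *m invmx P) \/
  (exists a b, b != 0 /\ A = P *m mx2 a b 0 a *m invmx P).
Proof.
have [P [a [b [d [Pu ->]]]]] := triangular_form A => nsc.
have [ad|ad] := eqVneq a d.
  exists P => //; right; exists a, b; rewrite -ad; split=> //.
  apply: contraNneq nsc => b0; rewrite -ad b0 -scalar_mx2 conj_scalar_mx //.
  exact: scalar_mx_is_scalar.
have da : d - a != 0 by rewrite subr_eq0 eq_sym.
pose U := mx2 1 (b / (d - a)) 0 1.
have Uu : U \in unitmx by rewrite unit_mx2 mulr1 mulr0 subr0 oner_eq0.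
exists (P *m U); first by rewrite unitmx_mul Pu.
left; exists a, d; split=> //.
have -> : mx2 a b 0 d = U *m mx2 a 0 0 d *m invmx U.
  by apply: (can_inj (mulmxK Uu)); rewrite mulmxKV // !mx2M; congr mx2; field.
have -> : invmx (P *m U) = invmx U *m invmx P.
  have PUu : P *m U \in unitmx by rewrite unitmx_mul Pu.
  apply: (can_inj (mulKmx PUu)); rewrite mulmxV // !mulmxA mulmxK // mulmxV //.
by rewrite !mulmxA.
Qed.

End MatrixGroups.

(** * The dichotomy for primitive groups *)

Section PrimitiveGroups.
Local Open Scope classical_set_scope.
Local Open Scope ring_scope.

Variables (C : closedFieldType) (charC : [pchar C] =i pred0).
Implicit Types (A B P : 'M[C]_2) (K : set 'M[C]_2) (p q : option C).

Lemma mxtrace_mx2 (a b c d : C) : \tr (mx2 a b c d) = a + d.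
Proof. by rewrite /mxtrace !big_ord_recl big_ord0 !mxE /= addr0. Qed.

Lemma mxtrace_conj P A : P \in unitmx -> \tr (P *m A *m invmx P) = \tr A.
Proof. by move=> Pu; rewrite mxtrace_mulC mulmxA mulVmx // mul1mx. Qed.

Lemma det_conj P A : P \in unitmx -> \det (P *m A *m invmx P) = \det A.
Proof.
move=> Pu; rewrite !det_mulmx mulrAC -det_mulmx mulmxV // det1 mul1r //.
Qed.

Lemma repeated_eigenvalue_form A : ~~ is_scalar_mx A ->
  (\tr A) ^+ 2 = 4%:R * \det A ->
  exists P a b, [/\ P \in unitmx, b != 0 & A = P *m mx2 a b 0 a *m invmx P].
Proof.
move=> /nonscalar_normal_form[P Pu [[a [b [ab ->]]]|[a [b [b0 ->]]] _]].
  rewrite mxtrace_conj // det_conj // mxtrace_mx2 det_mx2 => disc.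
  have /eqP : (a - b) ^+ 2 = 0.
    have -> : (a - b) ^+ 2 = (a + b) ^+ 2 - 4%:R * (a * b - 0 * 0) by ring.
    by rewrite disc subrr.
  by rewrite expf_eq0 /= subr_eq0 (negbTE ab).
by exists P, a, b.
Qed.

Lemma is_scalar_mx2 (a b c d : C) :
  is_scalar_mx (mx2 a b c d) = [&& b == 0, c == 0 & a == d].
Proof.
apply/is_scalar_mxP/and3P => [[x]|[/eqP-> /eqP-> /eqP->]].
  by rewrite scalar_mx2 => /mx2_inj[-> -> -> ->].
by exists d; rewrite scalar_mx2.
Qed.

(** The full diagonal group together with a matrix without vanishing diagonal
    entries that is not diagonal: scaling a column makes the discriminant of the
    characteristic polynomial vanish. *)
Lemma diagonal_times_nonscalar K (a b c d : C) : matrix_group K ->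
  (forall s, s != 0 -> K (mx2 s 0 0 1)) -> K (mx2 a b c d) ->
  a != 0 -> d != 0 -> (b != 0) || (c != 0) ->
  exists P x y, [/\ P \in unitmx, y != 0 & K (P *m mx2 x y 0 x *m invmx P)].
Proof.
move=> [_ _ KM _] KD KA a0 d0 bc0.
have [x x0 xE] : exists2 x, x != 0 &
    a ^+ 2 * x ^+ 2 + (2%:R * (a * d) - 4%:R * (a * d - b * c)) * x + d ^+ 2 = 0.
  by apply: exists_quadratic_root; rewrite expf_eq0.
pose A := mx2 a b c d *m mx2 x 0 0 1.
have AE : A = mx2 (a * x) b (c * x) d by rewrite /A mx2M; congr mx2; ring.
have KA' : K A by apply: (KM) => //; exact: KD.
have [||P [y [z [Pu z0 AE']]]] := @repeated_eigenvalue_form A.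
- rewrite AE is_scalar_mx2 mulf_eq0 (negbTE x0) orbF.
  by case/orP: bc0 => /negbTE-> //; rewrite andbF.
- rewrite AE mxtrace_mx2 det_mx2; apply/eqP; rewrite -subr_eq0 -xE; apply/eqP; ring.
by exists P, y, z; rewrite -AE'.
Qed.

(** An element moving a coordinate axis off both axes has a column without zeros. If
    a diagonal entry vanishes in it, the product of two copies of this element, with a
    suitable diagonal matrix in between, has nonzero diagonal entries. *)
Lemma primitive_diagonal K : cone_group K -> primitive K ->
  (forall s, s != 0 -> K (mx2 s 0 0 1)) ->
  exists P x y, [/\ P \in unitmx, y != 0 & K (P *m mx2 x y 0 x *m invmx P)].
Proof.
move=> [gK _] prK KD; have [Ku _ KM _] := gK.
have two0 : (2%:R : C) != 0 by rewrite ((pcharf0P C).1 charC).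
have pick (u v : C) : u != 0 -> exists2 s, s != 0 & u * s + v != 0.
  move=> u0; have [uv|uv] := eqVneq (u + v) 0; last by exists 1; rewrite ?oner_eq0 ?mulr1.
  exists 2%:R => //; rewrite (_ : _ + v = u + (u + v)); last by ring.
  by rewrite uv addr0.
have [A [p [KA]]] := prK [:: None; Some 0] isT isT.
have Au := Ku _ KA; have [a [b [c [d AE]]]] := mx2P A.
have det0 : a * d - b * c != 0 by rewrite -unit_mx2 -AE.
rewrite !inE => /orP[]/eqP-> {p}; rewrite negb_or.
  rewrite mobius_None_None // mobius_None_Some0 // AE !mxE /= => /andP[c0 a0].
  have [d0|d0] := eqVneq d 0; last first.
    by apply: (diagonal_times_nonscalar gK KD (a := a) (b := b) (c := c) (d := d)); rewrite -?AE ?c0 ?orbT.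
  have b0 : b != 0.
    by apply: contraNneq det0 => ->; rewrite d0 mulr0 mul0r subrr.
  have [s s0 sE] : exists2 s, s != 0 & a ^+ 2 * s + b * c != 0.
    by apply: pick; rewrite expf_eq0.
  apply: (diagonal_times_nonscalar gK KD (a := a ^+ 2 * s + b * c) (b := a * s * b)
            (c := c * s * a) (d := c * s * b)); rewrite ?mulf_neq0 //.
  have -> : mx2 (a ^+ 2 * s + b * c) (a * s * b) (c * s * a) (c * s * b) =
            A *m mx2 s 0 0 1 *m A by rewrite AE d0 !mx2M; congr mx2; ring.
  by apply: (KM) => //; apply: (KM) => //; exact: KD.
rewrite mobius_Some0_None // mobius_Some0_Some0 // AE !mxE /= => /andP[d0 b0].
have [a0|a0] := eqVneq a 0; last first.
  by apply: (diagonal_times_nonscalar gK KD (a := a) (b := b) (c := c) (d := d)); rewrite -?AE ?b0.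
have c0 : c != 0.
  by apply: contraNneq det0 => ->; rewrite a0 mulr0 mul0r subrr.
have [s s0 sE] : exists2 s, s != 0 & b * c * s + d ^+ 2 != 0.
  by apply: pick; rewrite mulf_neq0.
apply: (diagonal_times_nonscalar gK KD (a := b * c) (b := b * d)
          (c := c * d) (d := b * c * s + d ^+ 2)); rewrite ?mulf_neq0 //.
have -> : mx2 (b * c) (b * d) (c * d) (b * c * s + d ^+ 2) =
          A *m mx2 s 0 0 1 *m A by rewrite AE a0 !mx2M; congr mx2; ring.
by apply: (KM) => //; apply: (KM) => //; exact: KD.
Qed.

Definition full K := forall A, A \in unitmx -> K A.

(** Along the powers of a matrix with eigenvalues [a] and [b], polynomial functions
    of degree [d] see the whole torus as soon as [a / b] has order larger than [d]. *)
Lemma primitive_dichotomy d K : cone_group K -> clos_stable d K -> primitive K ->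
  full K \/ forall A, K A -> ~~ is_scalar_mx A -> exists P a b,
    [/\ P \in unitmx, a != b, A = P *m mx2 a 0 0 b *m invmx P &
        exists2 i, (0 < i <= d)%N & a ^+ i = b ^+ i].
Proof.
move=> gK clK prK; have [|nall] := pselect (forall A, K A -> ~~ is_scalar_mx A ->
    exists P a b, [/\ P \in unitmx, a != b, A = P *m mx2 a 0 0 b *m invmx P &
        exists2 i, (0 < i <= d)%N & a ^+ i = b ^+ i]); [by right|left].
have [A [KA nscA nA]] : exists A, [/\ K A, ~~ is_scalar_mx A & ~ exists P a b,
    [/\ P \in unitmx, a != b, A = P *m mx2 a 0 0 b *m invmx P &
        exists2 i, (0 < i <= d)%N & a ^+ i = b ^+ i]].
  apply: contrapT => no; apply: nall => A KA nscA; apply: contrapT => nA.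
  by apply: no; exists A.
have [P Pu [[a [b [ab AE]]]|[a [b [b0 AE]]]]] := nonscalar_normal_form nscA; last first.
  by apply: (primitive_unipotent_full (a := a) charC gK clK prK Pu b0); rewrite -AE.
have [Ku _ KM _] := gK.1.
have Kab : conj_set P K (mx2 a 0 0 b) by rewrite /conj_set /= -AE.
have {}gK' := cone_group_conj Pu gK; have clK' := clos_stable_conj Pu clK.
have prK' := primitive_conj Pu gK.1 prK.
have [Ku' K1' KM' _] := gK'.1.
have /norP[a0 b0] : ~~ ((a == 0) || (b == 0)).
  by have := Ku' _ Kab; rewrite unit_mx2 mulr0 subr0 mulf_eq0.
pose t := a / b.
have Kt (i : nat) : conj_set P K (mx2 (t ^+ i) 0 0 1).
  elim: i => [|i IHi]; first by move: K1'; rewrite scalar_mx2.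
  have -> : mx2 (t ^+ i.+1) 0 0 1 = mx2 (t ^+ i) 0 0 1 *m (b^-1 *: mx2 a 0 0 b).
    by rewrite mx2Z mx2M exprS /t; congr mx2; field.
  by apply: (KM') => //; apply: cone_groupZ => //; rewrite invr_eq0.
have lineE x : mx2 0 0 0 1 + x *: mx2 1 0 0 0 = mx2 x 0 0 (1 : C).
  by rewrite mx2Z mx2D; congr mx2; ring.
have KD s : s != 0 -> conj_set P K (mx2 s 0 0 1).
  move=> s0; rewrite -lineE; apply: clK'.
  apply: (@clos_line _ _ _ _ _ _ (fun i => t ^+ i)) => [i j /andP[ij jd]|i _|].
  - apply: contra_notN nA => /eqP tij; exists P, a, b; split=> //.
    exists (j - i)%N; first by lia.
    have ti0 : t ^+ i != 0 by rewrite expf_neq0 // mulf_neq0 ?invr_eq0.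
    have : t ^+ (j - i) = 1 by apply: (mulfI ti0); rewrite -exprD subnKC ?mulr1 // ltnW.
    rewrite expr_div_n => /(congr1 (fun x => x * b ^+ (j - i))).
    by rewrite divfK ?expf_neq0 // mul1r.
  - by rewrite lineE.
  - by rewrite lineE unit_mx2 mulr1 mulr0 subr0.
have [Q [x [y [Qu y0 KQ]]]] := primitive_diagonal gK' prK' KD.
apply: (conj_set_full Pu).
exact: (primitive_unipotent_full charC gK' clK' prK' Qu y0 KQ).
Qed.

Definition proportional A B := is_scalar_mx (invmx A *m B).

Definition finite_mod_scalars K := exists M, forall s : seq 'M[C]_2,
  (forall A, A \in s -> K A) -> pairwise (fun A B => ~~ proportional A B) s ->
  (size s <= M)%N.

(** Two consecutive terms of the sequence of polynomials in trace and determinant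
    that express [(a ^+ i - b ^+ i) / (a - b)] for the eigenvalues [a] and [b]. The
    value [i] at the identity separates scalars from matrices with [a ^+ i = b ^+ i]. *)
Fixpoint lucas (i : nat) A : C * C :=
  if i is k.+1 then
    let: (u, v) := lucas k A in (v, \tr A * v - \det A * u)
  else (0, 1).

Lemma lucas_diag i P (a b : C) : P \in unitmx ->
  (a - b) * (lucas i (P *m mx2 a 0 0 b *m invmx P)).1 = a ^+ i - b ^+ i /\
  (a - b) * (lucas i (P *m mx2 a 0 0 b *m invmx P)).2 = a ^+ i.+1 - b ^+ i.+1.
Proof.
move=> Pu; elim: i => [|i [IH1 IH2]] /=.
  by rewrite expr0 subrr mulr0 mulr1 !expr1.
case: (lucas _ _) IH1 IH2 => u v /= IH1 IH2; split=> //.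
rewrite mxtrace_conj // det_conj // mxtrace_mx2 det_mx2.
rewrite (_ : _ * _ = (a + b) * ((a - b) * v) - a * b * ((a - b) * u)); last by ring.
by rewrite IH1 IH2 !exprS; ring.
Qed.

Lemma lucas_scalar i (c : C) :
  (lucas i c%:M).1 * c = i%:R * c ^+ i /\ (lucas i c%:M).2 = i.+1%:R * c ^+ i.
Proof.
elim: i => [|i] /=; first by rewrite !mul0r expr0 mulr1.
case: (lucas _ _) => u v /= [IH1 IH2]; split.
  by rewrite IH2 exprS; ring.
rewrite scalar_mx2 mxtrace_mx2 det_mx2 mulr0 subr0 -mulrA [c * u]mulrC IH1 IH2.
by rewrite -!natr1 exprS; ring.
Qed.

Lemma polyfun_trace : polyfun 1 (fun A : 'M[C]_2 => \tr A).
Proof. by apply: polyfun_sum => i _; apply: polyfun_entry. Qed.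

Lemma polyfun_det : polyfun 2 (fun A : 'M[C]_2 => \det A).
Proof.
apply: (@polyfun_ext _ _ _ (fun A => A 0 0 * A 1 1 - A 0 1 * A 1 0)) => [A|].
  by rewrite [in RHS](mx2E A) det_mx2.
by apply: polyfunB; apply: (polyfunM (d := 1) (e := 1)); apply: polyfun_entry.
Qed.

Lemma polyfun_lucas i : polyfun i (fun A : 'M[C]_2 => (lucas i A).1).
Proof.
suff [] : polyfun i (fun A : 'M[C]_2 => (lucas i A).1) /\
          polyfun i.+1 (fun A : 'M[C]_2 => (lucas i A).2) by [].
elim: i => [|i [IH1 IH2]]; first by split; apply: polyfun_const.
split.
  by apply: polyfun_ext IH2 => A /=; case: (lucas _ _).
apply: (@polyfun_ext _ _ _
  (fun A => \tr A * (lucas i A).2 - \det A * (lucas i A).1)) => [A /=|].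
  by case: (lucas _ _).
apply: polyfunB; first exact: (polyfunM polyfun_trace IH2).
exact: (polyfunM polyfun_det IH1).
Qed.

(** If the ratios of eigenvalues of all elements have bounded order, a polynomial
    function isolates the scalars in [K]. Its translates isolate the other cosets of
    the scalars, and being linearly independent they are bounded in number. *)
Lemma bounded_order_finite d K : matrix_group K ->
  (forall A, K A -> ~~ is_scalar_mx A -> exists P a b,
    [/\ P \in unitmx, a != b, A = P *m mx2 a 0 0 b *m invmx P &
        exists2 i, (0 < i <= d)%N & a ^+ i = b ^+ i]) ->
  finite_mod_scalars K.
Proof.
move=> [Ku _ KM KV] ordK.
pose f A := \prod_(i <- iota 1 d) (lucas i A).1.
have pf : polyfun (\sum_(i <- iota 1 d) i)%N f.
  by apply: polyfun_prod => i; apply: polyfun_lucas.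
have f_eq0 A : K A -> (f A != 0) = is_scalar_mx A.
  move=> KA; have [/is_scalar_mxP[c AE]|nsc] := boolP (is_scalar_mx A).
    have c0 : c != 0.
      by have := Ku _ KA; rewrite AE scalar_mx2 unit_mx2 mulr0 subr0 mulf_eq0 orbb.
    rewrite /f AE prodf_seq_neq0; apply/allP => i; rewrite mem_iota => /andP[i0 _].
    apply/implyP => _; apply: contraTneq i0 => e0.
    have [/eqP + _] := lucas_scalar i c; rewrite e0 mul0r eq_sym mulf_eq0.
    by rewrite expf_eq0 (negbTE c0) andbF orbF ((pcharf0P C).1 charC) => /eqP->.
  have [P [a [b [Pu ab AE [i /andP[i0 id] abi]]]]] := ordK A KA nsc.
  apply/negbTE; rewrite negbK /f prodf_seq_eq0; apply/hasP; exists i.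
    by rewrite mem_iota i0 add1n ltnS.
  have [+ _] := lucas_diag i a b Pu.
  rewrite -AE abi subrr => /eqP; rewrite mulf_eq0 subr_eq0 (negbTE ab) /=.
  by [].
have [M MP] := polyfun_separated_bound C 2 (\sum_(i <- iota 1 d) i)%N.
exists M => s sK /(pairwiseP 1%:M) sP.
apply: (MP _ (fun (i : 'I_(size s)) A => f (invmx (nth 1%:M s i) *m A *m 1%:M))
             (fun j : 'I_(size s) => nth 1%:M s j)) => [i|i j].
  exact: polyfun_mulmx.
have Ks (k : 'I_(size s)) : K (nth 1%:M s k) by apply: sK; apply: mem_nth.
rewrite mulmx1 f_eq0; last by apply: (KM) => //; exact: KV.
have [->|] := eqVneq i j.
  by rewrite mulVmx ?Ku // scalar_mx_is_scalar.
rewrite -val_eqE neq_ltn => /orP[] ij; apply/negbTE.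
  by apply: sP; rewrite ?inE.
apply: contra (sP _ _ (ltn_ord j) (ltn_ord i) ij) => /is_scalar_mxP[c cE].
apply/is_scalar_mxP; exists (c^-1).
have siu := Ku _ (Ks i); have sju := Ku _ (Ks j).
have sE : nth 1%:M s j = c *: nth 1%:M s i.
  by rewrite -mul_scalar_mx -scalar_mxC -cE mulKVmx.
have c0 : c != 0 by apply: contraTneq sju => c0; rewrite sE c0 scale0r unitmxE det0 unitr0.
rewrite sE invmxZ -?sE ?unitfE //.
by rewrite -scalemxAl mulVmx // scalemx1.
Qed.

End PrimitiveGroups.

(** * Finite groups with two fixed points per element *)

Section FiniteRotationGroups.
Local Open Scope nat_scope.

(** With [e], [f], [g] the orders of the stabilizers on three orbits of sizes [a],
    [b], [c], the last hypothesis is the equation [1/e + 1/f + 1/g = 1 + 2/N]. Orbits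
    of size at least three exclude its dihedral solutions; the tetrahedral, octahedral
    and icosahedral ones remain. *)
Lemma three_orbit_arithmetic (N a b c e f g : nat) :
  a * e = N -> b * f = N -> c * g = N -> 1 < e -> 1 < f -> 1 < g ->
  2 < a -> 2 < b -> 2 < c -> a + b + c = N + 2 ->
  [/\ N \in [:: 12; 24; 60], forall t, t \in [:: a; b; c] -> N <= 5 * t,
      N = 12 -> 4 \in [:: a; b; c] & N = 24 -> 6 \in [:: a; b; c]].
Proof.
have sorted_case x y z p q r : x * p = N -> y * q = N -> z * r = N ->
    1 < p <= q -> q <= r -> 2 < x -> 2 < y -> 2 < z -> x + y + z = N + 2 ->
    [\/ [/\ N = 12, x = 6, y = 4 & z = 4], [/\ N = 24, x = 12, y = 8 & z = 6] |
        [/\ N = 60, x = 30, y = 20 & z = 12]].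
  move=> xp yq zr /andP[p1 pq] qr x3 y3 z3 S.
  have p2 : p = 2.
    apply/eqP; rewrite eqn_leq p1 andbT leqNgt; apply/negP => p3.
    have := leq_mul (leqnn x) p3; have := leq_mul (leqnn y) (leq_trans p3 pq).
    by have := leq_mul (leqnn z) (leq_trans (leq_trans p3 pq) qr); lia.
  have q3 : q <= 3.
    rewrite leqNgt; apply/negP => q4.
    have := leq_mul (leqnn y) q4; have := leq_mul (leqnn z) (leq_trans q4 qr).
    by move: xp; rewrite p2; lia.
  have {}q3 : q = 3.
    move: pq q3; rewrite p2; case: q yq qr => [|[|[|[|]]]] //= yq qr _ _.
    by move: xp; rewrite p2; lia.
  move: xp yq qr; rewrite p2 q3 => xp yq r3.
  have r5 : r <= 5.
    rewrite leqNgt; apply/negP => r6.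
    by have := leq_mul (leqnn z) r6; lia.
  case: r zr r3 r5 => [|[|[|[|[|[|]]]]]] //= zr _ _.
  - by constructor 1; split; lia.
  - by constructor 2; split; lia.
  - by constructor 3; split; lia.
move=> ae bf cg e1 f1 g1 a3 b3 c3 S.
have conclude x y z : [\/ [/\ N = 12, x = 6, y = 4 & z = 4],
    [/\ N = 24, x = 12, y = 8 & z = 6] | [/\ N = 60, x = 30, y = 20 & z = 12]] ->
    (forall t, (t \in [:: x; y; z]) = (t \in [:: a; b; c])) ->
    [/\ N \in [:: 12; 24; 60], forall t, t \in [:: a; b; c] -> N <= 5 * t,
      N = 12 -> 4 \in [:: a; b; c] & N = 24 -> 6 \in [:: a; b; c]].
  move=> cases pe; rewrite -!pe.
  have le5 t : t \in [:: a; b; c] -> N <= 5 * t.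
    rewrite -pe !inE.
    by case: cases => -[NE xE yE zE] /or3P[] /eqP->; rewrite NE ?xE ?yE ?zE.
  by split=> //; case: cases => -[NE xE yE zE]; rewrite NE ?xE ?yE ?zE.
have same x y z :
    (forall t, (t == x) || (t == y) || (t == z) = [|| t == a, t == b | t == c]) ->
    forall t, (t \in [:: x; y; z]) = (t \in [:: a; b; c]).
  by move=> E t; rewrite !inE -E orbA.
case: (leqP e f) => ef; case: (leqP f g) => fg; case: (leqP e g) => eg; try lia;
  [apply: (conclude a b c) | apply: (conclude a c b) | apply: (conclude c a b)
  |apply: (conclude b a c) | apply: (conclude b c a) | apply: (conclude c b a)];
  try (by apply: same => t; case: (t == a); case: (t == b); case: (t == c)).
- by apply: (sorted_case _ _ _ e f g) => //; lia.
- by apply: (sorted_case _ _ _ e g f) => //; lia.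
- by apply: (sorted_case _ _ _ g e f) => //; lia.
- by apply: (sorted_case _ _ _ f e g) => //; lia.
- by apply: (sorted_case _ _ _ f g e) => //; lia.
- by apply: (sorted_case _ _ _ g f e) => //; lia.
Qed.

(** The class equation for the rotation groups of the sphere: counting the fixed
    points of the nontrivial elements twice, as two per element and by orbits,
    leaves three orbits, of sizes determined by the order of the group. *)
Lemma two_fixed_points_orbits (X : finType) (G : {group {perm X}}) :
  0 < #|X| ->
  (forall s, s \in G -> s != 1%g -> #|[pred x | s x == x]| = 2) ->
  (forall x, exists2 s, s \in G & (s != 1%g) && (s x == x)) ->
  (forall x, 2 < #|orbit 'P G x|) ->
  [/\ #|G| \in [:: 12; 24; 60], forall x, #|G| <= 5 * #|orbit 'P G x|,
      #|G| = 12 -> exists x, #|orbit 'P G x| = 4 &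
      #|G| = 24 -> exists x, #|orbit 'P G x| = 6].
Proof.
move=> X0 fix2 fixX orb3.
have act : [acts G, on [set: X] | 'P].
  by apply/actsP => s _ x; rewrite !inE.
set Os := orbit 'P G @: [set: X].
have OsP O : O \in Os -> exists x, O = orbit 'P G x.
  by case/imsetP => x _ ->; exists x.
have OsE x : orbit 'P G x \in Os by apply: imset_f; rewrite inE.
have N1 : 0 < #|G| by apply: cardG_gt0.
have sumX : \sum_(O in Os) #|O| = #|X| by rewrite (acts_sum_card_orbit act) cardsT.
have burnside : #|X| + 2 * #|G|.-1 = #|Os| * #|G|.
  rewrite -(Frobenius_Cauchy act) (bigD1 1%g) ?group1 //=; congr (_ + _).
    by rewrite -cardsT; apply: eq_card => x; rewrite !inE finset.sub1set !inE /= /aperm perm1 eqxx.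
  rewrite (eq_bigr (fun=> 2)) => [|s /andP[sG s1]].
    rewrite sum_nat_const mulnC; congr (_ * _).
    have := cardsD1 1%g G; rewrite group1 => ->; rewrite add1n /=.
    by apply: eq_card => s; rewrite !inE andbC.
  rewrite -(fix2 s sG s1); apply: eq_card => x.
  by rewrite !inE finset.sub1set !inE /= /aperm.
have stab2 x : exists2 e, #|orbit 'P G x| * e = #|G| & 1 < e.
  exists #|('C_G[x | 'P])%g|; first exact: card_orbit_stab.
  have [s sG /andP[s1 /eqP sx]] := fixX x.
  rewrite (cardD1 1%g) (cardD1 s) !inE /= group1 sG s1 /= !finset.sub1set !inE /= /aperm.
  by rewrite perm1 sx !eqxx.
have half : 2 * #|X| <= #|Os| * #|G|.
  rewrite -sumX big_distrr /= -sum_nat_const; apply: leq_sum => O /OsP[x ->].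
  by have [e <- e1] := stab2 x; rewrite mulnC leq_mul2l e1 orbT.
have X3 : 2 < #|X|.
  have [x _] : exists x : X, x \in X by apply/card_gt0P.
  exact: leq_trans (orb3 x) (max_card _).
have Os3 : #|Os| = 3.
  case: #|Os| burnside half => [|[|[|[|k]]]] //; lia.
have [a [b [c Eabc]]] : exists a b c, enum Os = [:: a; b; c].
  move: Os3; rewrite cardE; case: (enum Os) => [|a [|b [|c [|]]]] // _.
  by exists a, b, c.
have inOs O : (O \in Os) = (O \in [:: a; b; c]) by rewrite -Eabc mem_enum.
have [[x aE] [y bE] [z cE]] : [/\ exists x, a = orbit 'P G x,
    exists y, b = orbit 'P G y & exists z, c = orbit 'P G z].
  by split; apply: OsP; rewrite inOs !inE eqxx ?orbT.
have [e ae e1] := stab2 x; have [f bf f1] := stab2 y; have [g cg g1] := stab2 z.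
have sum3 : #|a| + #|b| + #|c| = #|G| + 2.
  have : \sum_(O in Os) #|O| = #|a| + #|b| + #|c|.
    by rewrite -big_enum /= Eabc !big_cons big_nil addn0 addnA.
  by move: burnside; rewrite sumX Os3; lia.
rewrite aE bE cE in sum3 inOs.
have [cases le5 case12 case24] := three_orbit_arithmetic ae bf cg e1 f1 g1
  (orb3 x) (orb3 y) (orb3 z) sum3.
split=> // [t|/case12|/case24].
- apply: le5; have := OsE t; rewrite inOs !inE.
  by case/or3P => /eqP->; rewrite eqxx ?orbT.
- by rewrite !inE => /or3P[] /eqP E; [exists x | exists y | exists z].
- by rewrite !inE => /or3P[] /eqP E; [exists x | exists y | exists z].
Qed.

End FiniteRotationGroups.

(** * Finite primitive groups *)

Section FinitePrimitive.
Local Open Scope classical_set_scope.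
Local Open Scope ring_scope.

Variables (C : closedFieldType) (charC : [pchar C] =i pred0).
Variable K : set 'M[C]_2.
Hypotheses (gK : cone_group K) (prK : primitive K) (finK : finite_mod_scalars K).
Implicit Types (A B P : 'M[C]_2) (p q : option C).

Let Ku A : K A -> A \in unitmx. Proof. by case: gK.1 => Ku _ _ _; exact: Ku. Qed.
Let KM A B : K A -> K B -> K (A *m B). Proof. by case: gK.1 => _ _ KM _; exact: KM. Qed.
Let KV A : K A -> K (invmx A). Proof. by case: gK.1 => _ _ _; exact. Qed.

Lemma proportionalP A B : A \in unitmx -> B \in unitmx ->
  reflect (exists2 c, c != 0 & B = c *: A) (proportional A B).
Proof.
move=> Au Bu; apply: (iffP is_scalar_mxP) => [[c cE]|[c _ ->]]; exists c.
  apply: contraTneq Bu => c0; rewrite -[B](mulKVmx Au) cE c0 raddf0.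
    by rewrite mulmx0 unitmxE det0 unitr0.
  by rewrite -[B](mulKVmx Au) cE scalar_mxC mul_scalar_mx.
by rewrite -scalemxAr mulVmx // scalemx1.
Qed.

(** A matrix with a single fixed point is, up to a scalar, unipotent, hence of
    infinite order. *)
Lemma two_fixed_points A : K A -> ~~ is_scalar_mx A ->
  exists p q, p != q /\ forall x, (mobius A x == x) = (x == p) || (x == q).
Proof.
move=> KA /nonscalar_normal_form[P Pu [[a [b [ab AE]]]|[a [b [b0 AE]]]]].
  have Du : mx2 a 0 0 b \in unitmx by rewrite -(conj_unitmx _ Pu) -AE Ku.
  have fixD x : (mobius (mx2 a 0 0 b) x == x) = (x == None) || (x == Some 0).
    rewrite mobius_eq // /wedge /mulv !mxE /=; case: x => [t|] /=; last first.
      by rewrite !(mulr0, mul0r, addr0, subr0) !eqxx.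
    rewrite !mulr1 !mul0r addr0 add0r -mulrBl mulf_eq0 subr_eq0 (negbTE ab) /=.
    by rewrite (inj_eq (@Some_inj _)).
  exists (mobius P None), (mobius P (Some 0)).
  split=> [|x]; first by rewrite (inj_eq (mobius_inj Pu)).
  have -> : mobius A x = mobius P (mobius (mx2 a 0 0 b) (mobius (invmx P) x)).
    by rewrite AE !mobiusM ?unitmx_mul ?unitmx_inv ?Pu.
  rewrite -{2 3 4}[x](mobiusVK x Pu) !(inj_eq (mobius_inj Pu)).
  exact: fixD.
have a0 : a != 0.
  have := Ku KA; rewrite AE conj_unitmx // unit_mx2 mulr0 subr0 mulf_eq0.
  by rewrite orbb.
have ba0 : b / a != 0 by rewrite mulf_neq0 ?invr_eq0.
pose u (i : nat) := P *m mx2 1 (i%:R * (b / a)) 0 1 *m invmx P.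
have Ku_ i : K (u i).
  elim: i => [|i IHi].
    by rewrite /u mul0r -scalar_mx2 conj_scalar_mx //; apply: gK.2; rewrite oner_eq0.
  have -> : u i.+1 = u i *m (a^-1 *: A).
    rewrite AE /u scalemxAl scalemxAr -conj_mulmx // mx2Z mx2M; congr (_ *m _ *m _).
    by rewrite -natr1; congr mx2; field.
  by apply: KM => //; apply: cone_groupZ => //; rewrite invr_eq0.
have uu i : mx2 1 (i%:R * (b / a)) 0 1 \in unitmx.
  by rewrite unit_mx2 mulr1 mulr0 subr0 oner_eq0.
have [M sM] := finK.
suff : (size [seq u i | i <- iota 0 M.+1] <= M)%N by rewrite size_map size_iota ltnn.
apply: sM => [B /mapP[i _ ->]//|].
rewrite pairwise_map; apply/(pairwiseP 0%N) => i j.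
rewrite !unfold_in size_iota => iM jM ij; rewrite !nth_iota // !add0n.
apply/negP => /proportionalP[||c c0]; rewrite ?Ku //.
rewrite /u scalemxAl scalemxAr => /(congr1 (fun X => invmx P *m X *m P)).
rewrite !conj_mulmxVK // mx2Z => /mx2_inj[+ + _ _]; rewrite mulr1 => <-.
rewrite mul1r => /(mulIf ba0)/eqP; rewrite natr_inj_char0 // => /eqP ji.
by move: ij; rewrite ji ltnn.
Qed.

Lemma coset_representatives : exists s : seq 'M[C]_2,
  [/\ forall A, A \in s -> K A, pairwise (fun A B => ~~ proportional A B) s &
      forall A, K A -> exists2 B, B \in s & proportional A B].
Proof.
have [M sM] := finK.
pose Q k := `[< exists s : seq 'M[C]_2, [/\ forall A, A \in s -> K A,
  pairwise (fun A B => ~~ proportional A B) s & size s = k] >].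
have Q0 : exists k, Q k by exists 0%N; apply/asboolP; exists [::].
have QM k : Q k -> (k <= M)%N by move=> /asboolP[s [sK sP <-]]; exact: sM.
have [k /asboolP[s [sK sP sk]] kmax] := ex_maxnP Q0 QM.
exists s; split=> // A KA; apply/hasP; apply: contraT => /hasPn nA.
have /kmax : Q k.+1.
  apply/asboolP; exists (A :: s); split=> [B||]; last by rewrite /= sk.
    by rewrite inE => /orP[/eqP->//|]; exact: sK.
  by rewrite /= sP andbT; apply/allP.
by rewrite ltnn.
Qed.

Lemma exists_nonscalar : exists2 A, K A & ~~ is_scalar_mx A.
Proof.
have [A [p [KA]]] := prK (O := [:: None]) isT isT.
rewrite !inE => /eqP-> nfix; exists A => //; apply: contra nfix => /is_scalar_mxP[c AE].
have c0 : c != 0.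
  by have := Ku KA; rewrite AE scalar_mx2 unit_mx2 mulr0 subr0 mulf_eq0 orbb.
by rewrite AE -[c%:M]scalemx1 mobiusZ // mobius1.
Qed.

Definition fixed_by_nonscalar p := exists A, [/\ K A, ~~ is_scalar_mx A & mobius A p = p].

Lemma is_scalar_mxZ c A : c != 0 -> is_scalar_mx (c *: A) = is_scalar_mx A.
Proof.
move=> c0; apply/is_scalar_mxP/is_scalar_mxP => [[x cA]|[x ->]].
  by exists (c^-1 * x); rewrite -scale_scalar_mx -cA scalerK.
by exists (c * x); rewrite scale_scalar_mx.
Qed.

Lemma fixed_points_seq : exists2 T : seq (option C), uniq T &
  forall p, p \in T <-> fixed_by_nonscalar p.
Proof.
have [s [sK _ sC]] := coset_representatives.
have /choice[F FP] A : exists t : seq (option C), K A -> ~~ is_scalar_mx A ->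
    forall x, (mobius A x == x) = (x \in t).
  have [KA|nKA] := pselect (K A); last by exists [::].
  have [scA|nscA] := boolP (is_scalar_mx A); first by exists [::].
  have [p [q [_ pqE]]] := two_fixed_points KA nscA.
  by exists [:: p; q] => _ _ x; rewrite pqE !inE.
exists (undup (flatten [seq F A | A <- s & ~~ is_scalar_mx A])).
  exact: undup_uniq.
move=> p; rewrite mem_undup; split=> [/flatten_mapP[A]|[A [KA nscA Ap]]].
  rewrite mem_filter => /andP[nscA /sK KA]; rewrite -FP // => /eqP Ap.
  by exists A.
have [B Bs /proportionalP] := sC A KA; have BK := sK _ Bs.
move=> /(_ (Ku KA) (Ku BK))[c c0 BE].
have nscB : ~~ is_scalar_mx B by rewrite BE is_scalar_mxZ.
apply/flatten_mapP; exists B; first by rewrite mem_filter nscB.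
by rewrite -FP // BE mobiusZ // Ap.
Qed.

Lemma fixed_by_nonscalar_mobius A p : K A -> fixed_by_nonscalar p ->
  fixed_by_nonscalar (mobius A p).
Proof.
move=> KA [B [KB nscB Bp]]; have Au := Ku KA; have Bu := Ku KB.
exists (A *m B *m invmx A); split; first by apply: KM; [exact: KM | exact: KV].
  apply: contra nscB => /is_scalar_mxP[c cE]; apply/is_scalar_mxP; exists c.
  by rewrite -(conj_mulmxVK B Au) cE scalar_mxC -mulmxA mulVmx // mulmx1.
by rewrite !mobiusM ?unitmx_mul ?unitmx_inv ?Au // mobiusK // Bp.
Qed.

Definition projective_order (X : set 'M[C]_2) N := exists s : seq 'M[C]_2,
  [/\ size s = N, forall A, A \in s -> X A,
      pairwise (fun A B => ~~ proportional A B) s &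
      forall A, X A -> exists2 B, B \in s & proportional A B].

Definition mobius_invariant (X : set 'M[C]_2) (O : seq (option C)) :=
  forall A p, X A -> p \in O -> mobius A p \in O.

(** The finite group is the one induced on the set of points with a nontrivial
    stabilizer; the action on it is faithful, because primitivity gives it at least
    three points. *)
Lemma finite_primitive_orbits : exists N, [/\ projective_order K N,
  N \in [:: 12; 24; 60]%N,
  forall (O : seq (option C)) p, fixed_by_nonscalar p -> mobius_invariant K O -> p \in O ->
    (N <= 5 * size O)%N &
  forall r, (N, r) \in [:: (12, 4); (24, 6)]%N -> exists O p,
    [/\ size O = r, mobius_invariant K O, fixed_by_nonscalar p & p \in O]].
Proof.
have [T Tu TP] := fixed_points_seq.
have Tinv : mobius_invariant K T.
  by move=> A p KA /TP fp; apply/TP; exact: fixed_by_nonscalar_mobius.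
have invariant3 O : O != [::] -> mobius_invariant K O -> (2 < size O)%N.
  move=> O0 Oinv; rewrite ltnNge; apply/negP => /(prK O0)[A [p [KA pO]]].
  by rewrite Oinv.
have [p0 p0T] : exists p, p \in T.
  have [A KA nscA] := exists_nonscalar.
  have [p [q [_ pqE]]] := two_fixed_points KA nscA.
  by exists p; apply/TP; exists A; split=> //; apply/eqP; rewrite pqE eqxx.
have T3 : (2 < size T)%N by apply: invariant3 => //; apply: contraTneq p0T => ->.
pose X := seq_sub T.
have /choice[rho rhoP] A : exists s : {perm X}, K A -> forall x, val (s x) = mobius A (val x).
  have [KA|nKA] := pselect (K A); last by exists 1%g.
  pose f (x : X) : X := SeqSub (Tinv A _ KA (valP x)).
  have f_inj : injective f.
    by move=> x y /(congr1 val)/(mobius_inj (Ku KA)) xy; apply: val_inj.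
  by exists (perm f_inj) => _ x; rewrite permE.
pose Gam : {set {perm X}} := finset (fun s : {perm X} =>
  `[< exists2 A, K A & forall x, val (s x) = mobius A (val x) >]).
have GamP (s : {perm X}) :
    s \in Gam <-> exists2 A, K A & forall x, val (s x) = mobius A (val x).
  by rewrite inE; split=> /asboolP.
have rhoG A : K A -> rho A \in Gam by move=> KA; apply/GamP; exists A => //; exact: rhoP.
have gGam : group_set Gam.
  apply/group_setP; split=> [|s t /GamP[A KA sA] /GamP[B KB tB]]; apply/GamP.
    by exists 1%:M => [|x]; [apply: gK.2; rewrite oner_eq0 | rewrite perm1 mobius1].
  exists (B *m A) => [|x]; first exact: KM.
  by rewrite permM tB sA mobiusM ?Ku.
pose G := Group gGam.
have faithful A : K A -> (forall x, x \in T -> mobius A x = x) -> is_scalar_mx A.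
  move=> KA fixT; apply: contraLR T3 => nscA; rewrite -leqNgt.
  have [p [q [_ pqE]]] := two_fixed_points KA nscA.
  apply: (uniq_leq_size (s2 := [:: p; q])) => // x xT.
  by rewrite !inE -pqE fixT.
have [s [sK sP sC]] := coset_representatives.
have rho_prop A B : K A -> K B -> rho A = rho B -> proportional A B.
  move=> KA KB rAB; apply: faithful => [|x xT]; first by apply: KM => //; exact: KV.
  rewrite mobiusM ?unitmx_inv ?Ku // -(rhoP _ KB (SeqSub xT)) -rAB rhoP //=.
  by rewrite mobiusK ?Ku.
have cardG : #|G| = size s.
  rewrite -(size_map rho); have /card_uniqP <- : uniq (map rho s).
    rewrite uniq_pairwise pairwise_map.
    apply: (sub_in_pairwise (P := mem s)) sP; last by apply/allP.
    move=> A B As Bs /=; apply: contra => /eqP; exact: rho_prop (sK _ As) (sK _ Bs).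
  apply: eq_card => t; apply/idP/mapP => [/GamP[A KA tA]|[A As ->]]; last first.
    by apply: rhoG; exact: sK.
  have [B Bs /proportionalP] := sC A KA; have BK := sK _ Bs.
  move=> /(_ (Ku KA) (Ku BK))[c c0 BE]; exists B => //.
  by apply/permP => x; apply: val_inj; rewrite tA rhoP // BE mobiusZ.
have orbE x t : t \in orbit 'P G x -> exists2 A, K A & val t = mobius A (val x).
  by case/orbitP => u /GamP[A KA uA] <-; exists A => //; rewrite -uA.
have mem_orb x A : K A -> rho A x \in orbit 'P G x.
  by move=> KA; apply/orbitP; exists (rho A); first exact: rhoG.
pose orb x := [seq val t | t <- enum (orbit 'P G x)].
have size_orb x : size (orb x) = #|orbit 'P G x| by rewrite size_map cardE.
have orb_self x : val x \in orb x.
  by apply: map_f; rewrite mem_enum; exact: orbit_refl.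
have orb_inv x : mobius_invariant K (orb x).
  move=> A p KA /mapP[t]; rewrite mem_enum => /orbitP[u /GamP[B KB uB] <-] ->.
  apply/mapP; exists (rho (A *m B) x); first by rewrite mem_enum; apply/mem_orb/KM.
  by rewrite rhoP ?mobiusM ?Ku //= ?uB //; exact: KM.
have [||||cases le5 case12 case24] := @two_fixed_points_orbits X G.
- by apply/card_gt0P; exists (SeqSub p0T).
- move=> t /GamP[A KA tA] t1.
  have nscA : ~~ is_scalar_mx A.
    apply: contra t1 => /is_scalar_mxP[c AE].
    have c0 : c != 0.
      by have := Ku KA; rewrite AE scalar_mx2 unit_mx2 mulr0 subr0 mulf_eq0 orbb.
    apply/eqP/permP => x; apply: val_inj.
    by rewrite tA perm1 AE -[c%:M]scalemx1 mobiusZ // mobius1.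
  have [p [q [pq pqE]]] := two_fixed_points KA nscA.
  have inT x : (x == p) || (x == q) -> x \in T.
    by rewrite -pqE => /eqP xA; apply/TP; exists A.
  have pT : p \in T by apply: inT; rewrite eqxx.
  have qT : q \in T by apply: inT; rewrite eqxx orbT.
  transitivity #|pred2 (SeqSub pT) (SeqSub qT)|; last by rewrite card2 -val_eqE /= pq.
  by apply: eq_card => x; rewrite !inE -!val_eqE /= tA pqE.
- move=> x; have /TP[A [KA nscA Ax]] := valP x.
  exists (rho A); first exact: rhoG.
  have -> : rho A x = x by apply: val_inj; rewrite rhoP.
  rewrite eqxx andbT; apply: contra nscA => /eqP r1.
  apply: faithful => // y yT.
  by rewrite -(rhoP _ KA (SeqSub yT)) r1 perm1.
- move=> x; rewrite -size_orb; apply: invariant3 => //.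
  by apply: contraTneq (orb_self x) => ->.
exists (size s); rewrite -cardG; split=> //.
- by exists s.
- move=> O p /TP pT Oinv pO.
  apply: leq_trans (le5 (SeqSub pT)) _; rewrite leq_mul2l /= -size_orb.
  apply: uniq_leq_size => [|q /mapP[t]].
    by rewrite map_inj_uniq ?enum_uniq //; exact: val_inj.
  by rewrite mem_enum => /orbE[A KA tA] ->; rewrite tA; exact: Oinv.
- move=> r; rewrite !inE !xpair_eqE => /orP[] /andP[/eqP N /eqP->].
    have [x xO] := case12 N; exists (orb x), (val x); rewrite size_orb.
    by split=> //; apply/TP; exact: valP.
  have [x xO] := case24 N; exists (orb x), (val x); rewrite size_orb.
  by split=> //; apply/TP; exact: valP.
Qed.

End FinitePrimitive.

(** * Counting sextic forms *)

Section SexticCount.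
Local Open Scope classical_set_scope.
Local Open Scope ring_scope.

Variable C : closedFieldType.
Implicit Types (A B : 'M[C]_2) (K : set 'M[C]_2).

(** Exponents of the last three entries in the monomials of degree six. *)
Definition sextic_exponents : seq (nat * nat * nat) :=
  [seq t <- [seq (jk, l) | jk <- [seq (j, k) | j <- iota 0 7, k <- iota 0 7], l <- iota 0 7]
     | t.1.1 + t.1.2 + t.2 <= 6]%N.

Definition kronecker_exponent (t : nat * nat * nat) := (t.1.1 + 7 * t.1.2 + 49 * t.2)%N.

Definition sextic_monomial (t : nat * nat * nat) A : C :=
  A 0 0 ^+ (6 - (t.1.1 + t.1.2 + t.2)) *
    (A 0 1 ^+ t.1.1 * (A 1 0 ^+ t.1.2 * A 1 1 ^+ t.2)).

Lemma size_sextic_exponents : size sextic_exponents = 84%N.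
Proof. by vm_compute. Qed.

Lemma uniq_kronecker_exponents : uniq [seq kronecker_exponent t | t <- sextic_exponents].
Proof. by vm_compute. Qed.

Lemma polyfun_sextic_monomial t : t \in sextic_exponents ->
  polyfun 6 (sextic_monomial t).
Proof.
rewrite mem_filter => /andP[t6 _].
have pX i j k : polyfun (1 * k) (fun A : 'M[C]_2 => A i j ^+ k).
  by apply: polyfunX; apply: polyfun_entry.
have := polyfunM (pX 0 0 (6 - (t.1.1 + t.1.2 + t.2))%N)
  (polyfunM (pX 0 1 t.1.1) (polyfunM (pX 1 0 t.1.2) (pX 1 1 t.2))).
by apply: polyfun_leq; move: (t.1.1) (t.1.2) (t.2) t6 => j k l; lia.
Qed.

Lemma sextic_monomialZ t c A : t \in sextic_exponents ->
  sextic_monomial t (c *: A) = c ^+ 6 * sextic_monomial t A.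
Proof.
rewrite mem_filter => /andP[t6 _]; rewrite /sextic_monomial !mxE !exprMn.
rewrite -[in c ^+ 6](subnK t6) !exprD.
move: (c ^+ (6 - _)) (c ^+ t.1.1) (c ^+ t.1.2) (c ^+ t.2) => c0 c1 c2 c3.
by move: (_ ^+ _) (_ ^+ _) (_ ^+ _) (_ ^+ _) => a0 a1 a2 a3; ring.
Qed.

(** The sextic forms in four variables have dimension 84, so that some nonzero one
    vanishes on fewer than 84 lines; it stays nonzero at a matrix whose entries are
    powers of one indeterminate chosen to keep the monomials distinct. *)
Lemma clos6_not_full K N : (forall A, K A -> A \in unitmx) ->
  projective_order K N -> (N < 84)%N -> ~ full (clos 6 K).
Proof.
move=> Ku [s [<- sK _ sC]] sN.
pose L := sextic_exponents.
pose M := \matrix_(i < 84, j < size s)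
  sextic_monomial (nth (0, 0, 0)%N L i) (nth 1%:M s j).
have Lin (i : 'I_84) : nth (0, 0, 0)%N L i \in L.
  by apply: mem_nth; rewrite size_sextic_exponents.
have : kermx M != 0.
  rewrite kermx_eq0 /row_free neq_ltn.
  by rewrite (leq_ltn_trans (rank_leq_col M) sN).
case/rowV0Pn => u /sub_kermxP uM u0.
pose f A := \sum_(i < 84) u 0 i * sextic_monomial (nth (0, 0, 0)%N L i) A.
have pf : polyfun 6 f.
  by apply: polyfun_sum => i _; apply/polyfunZ/polyfun_sextic_monomial.
have fK : vanishes f K.
  move=> A KA; have [B Bs /proportionalP] := sC A KA.
  move=> /(_ (Ku _ KA) (Ku _ (sK _ Bs)))[c c0 BE].
  have fB : f B = 0.
    have Bi : (index B s < size s)%N by rewrite index_mem.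
    have /matrixP/(_ 0 (Ordinal Bi)) := uM; rewrite !mxE => <-.
    by apply: eq_bigr => i _; rewrite mxE /= nth_index.
  apply: (mulfI (expf_neq0 6 c0)); rewrite mulr0.
  rewrite -fB BE /f big_distrr /=; apply: eq_bigr => i _.
  by rewrite sextic_monomialZ // [RHS]mulrCA.
pose E (i : 'I_84) := kronecker_exponent (nth (0, 0, 0)%N L i).
have E_inj : injective E.
  move=> i j /eqP; rewrite /E -!(nth_map _ 0%N) ?size_sextic_exponents // nth_uniq;
    rewrite ?size_map ?size_sextic_exponents ?uniq_kronecker_exponents //.
  by move/eqP/val_inj.
pose q := \sum_i u 0 i *: 'X^(E i).
pose At (t : C) := mx2 1 t (t ^+ 7) (t ^+ 49).
have fAt t : f (At t) = q.[t].
  rewrite horner_sum; apply: eq_bigr => i _; rewrite hornerZ hornerXn.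
  congr (_ * _); rewrite /sextic_monomial !mxE /= expr1n mul1r -!exprM -!exprD.
  by congr (_ ^+ _); rewrite /E /kronecker_exponent addnA.
have q0 : q != 0.
  apply: contraNneq u0 => q0; apply/eqP/rowP => i; rewrite mxE.
  have := coef0 C (E i); rewrite -q0 coef_sum (bigD1 i) //= coefZ coefXn eqxx mulr1.
  rewrite big1 ?addr0 // => j ji; rewrite coefZ coefXn.
  by rewrite (inj_eq E_inj) eq_sym (negbTE ji) mulr0.
have det0 : ('X^49 - 'X^8 : {poly C}) != 0.
  apply: contra_eq_neq (coefXn C 49 49) => /eqP; rewrite subr_eq0 => /eqP->.
  by rewrite coefXn /= eq_sym oner_eq0.
have /closed_nonrootP[t] := mulf_neq0 q0 det0.
rewrite rootM negb_or /root !hornerE -fAt => /andP[ft dt].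
have Atu : At t \in unitmx.
  by rewrite unit_mx2 mul1r; move: dt; rewrite -exprS.
move=> /(_ _ Atu)[_ /(_ f pf fK)/eqP]; exact/negP.
Qed.

End SexticCount.

(** * Independence of exponential polynomials *)

Section ExponentialPolynomials.
Local Open Scope ring_scope.

Variables (C : closedFieldType) (charC : [pchar C] =i pred0).

Lemma poly_eq0_on_multiples (p : {poly C}) (b : C) : b != 0 ->
  (forall k : nat, p.[k%:R * b] = 0) -> p = 0.
Proof.
move=> b0 pk; apply: (@poly_eq0_of_roots _ p (fun k => k%:R * b) (size p)) => // i j.
move=> /andP[ij _]; apply: contraTneq ij => /(mulIf b0)/eqP.
by rewrite natr_inj_char0 // => /eqP->; rewrite ltnn.
Qed.

Lemma comp_shift (p : {poly C}) : let q := p \Po ('X + 1%:P) in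
  size q = size p /\ lead_coef q = lead_coef p.
Proof.
have sX := size_XaddC (1 : C); split; first exact: size_comp_poly2.
by rewrite lead_coef_comp ?sX // lead_coefXaddC expr1n mulr1.
Qed.

(** Applying the shift of [k] minus the scalar [l j0] lowers the degree of the
    coefficient of [l j0 ^+ k] and does not raise that of the others, which allows an
    induction on the sum of the sizes. *)
Lemma exponential_polynomial_independence n (l : 'I_n -> C) (p : 'I_n -> {poly C}) :
  injective l -> (forall j, l j != 0) ->
  (forall k : nat, \sum_j l j ^+ k * (p j).[k%:R] = 0) -> forall j, p j = 0.
Proof.
move=> l_inj l0; have [m] := ubnP (\sum_j size (p j))%N.
elim: m p => [//|m IHm] p; rewrite ltnS => pm pk j0.
apply/eqP; apply: contraT => pj0.
pose p' j := l j *: (p j \Po ('X + 1%:P)) - l j0 *: p j.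
have size_p' j : (size (p' j) <= size (p j))%N.
  apply: leq_trans (size_polyD _ _) _; rewrite size_polyN geq_max.
  by rewrite !(leq_trans (size_scale_leq _ _)) // (comp_shift (p j)).1.
have size_p'0 : (size (p' j0) < size (p j0))%N.
  rewrite -(prednK (n := size (p j0))) ?size_poly_gt0 // ltnS.
  apply/leq_sizeP => i; rewrite leq_eqVlt => /orP[/eqP<-|ip].
    rewrite coefB !coefZ -[X in _ - X]/(l j0 * lead_coef (p j0)).
    by rewrite -{1}(comp_shift (p j0)).1 -/(lead_coef _) (comp_shift (p j0)).2 subrr.
  apply: (nth_default 0 (leq_trans (size_p' j0) _)).
  by move: ip; case: (size (p j0)).
have p'0 : forall j, p' j = 0.
  apply: IHm => [|k].
    apply: leq_trans pm; rewrite (bigD1 j0) //= [X in (_ < X)%N](bigD1 j0) //=.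
    by rewrite -addSn leq_add // leq_sum.
  transitivity (\sum_j l j ^+ k.+1 * (p j).[k.+1%:R] -
                l j0 * \sum_j l j ^+ k * (p j).[k%:R]).
    rewrite big_distrr -sumrB; apply: eq_bigr => j _ /=.
    rewrite /p' exprS !hornerE horner_comp !hornerE natr1.
    by rewrite mulrBr !mulrA [l j ^+ k * l j]mulrC [l j ^+ k * l j0]mulrC.
  by rewrite !pk mulr0 subrr.
have pj j : j != j0 -> p j = 0.
  move=> jj0; apply/eqP; rewrite -lead_coef_eq0; apply: contraTT isT => lead0.
  have /(congr1 (fun q : {poly C} => q`_(size (p j)).-1)) := p'0 j.
  rewrite /p' coefB !coefZ coef0 -[X in _ - X]/(l j0 * lead_coef (p j)).
  rewrite -{1}(comp_shift (p j)).1 -/(lead_coef _) (comp_shift (p j)).2 -mulrBl.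
  move/eqP; rewrite mulf_eq0 (negbTE lead0) orbF subr_eq0 (inj_eq l_inj).
  by rewrite (negbTE jj0).
suff p00 : p j0 = 0 by rewrite p00 eqxx in pj0.
apply: (poly_eq0_on_multiples (oner_neq0 _)) => k; rewrite mulr1.
apply: (mulfI (expf_neq0 k (l0 j0))); rewrite mulr0 -(pk k) (bigD1 j0) //=.
by rewrite big1 ?addr0 // => j jj0; rewrite pj // horner0 mulr0.
Qed.

End ExponentialPolynomials.

(** * Tori and change of basis *)

Section Tori.
Local Open Scope classical_set_scope.
Local Open Scope ring_scope.

Variables (C : closedFieldType).
Implicit Types (A B P : 'M[C]_2) (T X G H : set 'M[C]_2).

Lemma bounded_zariski_closed d X : bounded_by d X -> zariski_closed X.
Proof. by move=> [fs [_ ->]]; exists [set f | f \in fs]. Qed.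

Lemma zariski_closed_conj P X : P \in unitmx -> zariski_closed X ->
  zariski_closed (conj_set P X).
Proof.
move=> Pu /zariski_closedP[Xu sepX]; apply/zariski_closedP; split=> [A /Xu|A Au nXA].
  by rewrite conj_unitmx.
have [|d [f [pf f0 fA]]] := sepX _ _ nXA; first by rewrite conj_unitmx.
exists d, (fun B => f (P *m B *m invmx P)).
by split=> [|B /f0//|//]; exact: polyfun_mulmx.
Qed.

Lemma algebraic_groupP G : algebraic_group G <-> zariski_closed G /\ matrix_group G.
Proof.
split=> [[cG G1 GM GV]|[cG [_ G1 GM GV]]]; last by split.
by split=> //; split=> //; case/zariski_closedP: cG.
Qed.

Lemma algebraic_group_conj P G : P \in unitmx -> algebraic_group G ->
  algebraic_group (conj_set P G).
Proof.
move=> Pu /algebraic_groupP[cG gG]; apply/algebraic_groupP.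
by split; [exact: zariski_closed_conj | exact: matrix_group_conj].
Qed.

Lemma bounded_by_conj d P X : P \in unitmx -> bounded_by d X ->
  bounded_by d (conj_set P X).
Proof.
move=> Pu [fs [sfs ->]]; apply: bounded_byP => [A [] |A Au fA].
  by rewrite conj_unitmx.
split=> [|p /= pfs]; first by rewrite conj_unitmx.
apply: (fA (fun B => p.@[mxvec (P *m B *m invmx P) 0])) => [|B [_]]; last exact.
apply: (@polyfun_mulmx _ _ _ (fun B => p.@[mxvec B 0])).
by exists p => //; exact: sfs.
Qed.

Lemma zariski_connected_conj P X : P \in unitmx -> zariski_connected X ->
  zariski_connected (conj_set P X).
Proof.
move=> Pu [[A XA] connX]; split.
  by exists (invmx P *m A *m P); rewrite /conj_set /= conj_mulmxK.
move=> Y Z cY cZ XYZ dXYZ; have Vu : invmx P \in unitmx by rewrite unitmx_inv.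
have conj_sub W : conj_set P X `<=` W <-> X `<=` conj_set (invmx P) W.
  rewrite /conj_set; split=> sub B /=.
    by move=> XB; apply: sub; rewrite /= invmxK conj_mulmxK.
  by move=> /sub; rewrite /= invmxK conj_mulmxVK.
have [||sub|sub] := connX _ _ (zariski_closed_conj Vu cY) (zariski_closed_conj Vu cZ).
- by move=> B XB; apply: (proj1 (conj_sub (Y `|` Z))).
- apply/seteqP; split=> // B [XB [YB ZB]].
  have : (conj_set P X `&` (Y `&` Z)) (invmx P *m B *m P).
    move: YB ZB; rewrite /conj_set /= invmxK => YB ZB.
    by split; [rewrite /= conj_mulmxK|split].
  by rewrite dXYZ.
- by left; apply/conj_sub.
- by right; apply/conj_sub.
Qed.

Lemma diagonalizableE A : diagonalizable A <->
  exists2 P, P \in unitmx & is_diag_mx (P *m A *m invmx P).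
Proof.
split=> [[P Pu]|[P Pu dA]].
  by move=> dA; exists P => //; rewrite -conjumx.
by exists P => //; move: dA; rewrite -conjumx.
Qed.

Lemma torus_conj P T : P \in unitmx -> torus T -> torus (conj_set P T).
Proof.
move=> Pu [aT commT connT diagT]; split.
- exact: algebraic_group_conj.
- move=> A B TA TB; have := commT _ _ TA TB; rewrite -!conj_mulmx // => AB.
  by rewrite -(conj_mulmxVK (A *m B) Pu) AB conj_mulmxVK.
- exact: zariski_connected_conj.
- move=> A /diagT/diagonalizableE[Q Qu dA]; apply/diagonalizableE.
  have QPu : Q *m P \in unitmx by rewrite unitmx_mul Qu.
  exists (Q *m P) => //; suff -> : invmx (Q *m P) = invmx P *m invmx Q.
    by rewrite !mulmxA in dA *.
  by apply: (can_inj (mulKmx QPu)); rewrite mulmxV // !mulmxA mulmxK // mulmxV.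
Qed.

(** A group cut out of the invertible matrices by linear conditions is irreducible:
    two polynomial functions each nonzero somewhere on it are both nonzero at some
    point of the line through these places. *)
Lemma linear_torus T : algebraic_group T ->
  (forall A B, T A -> T B -> A *m B = B *m A) ->
  (forall A, T A -> diagonalizable A) ->
  (forall A B s, T A -> T B -> A + s *: (B - A) \in unitmx -> T (A + s *: (B - A))) ->
  torus T.
Proof.
move=> aT commT diagT lineT; split=> //; have /algebraic_groupP[_ [Tu T1 _ _]] := aT.
split; first by exists 1%:M.
move=> Y Z /zariski_closedP[_ sepY] /zariski_closedP[_ sepZ] TYZ _.
apply: contrapT => /not_orP[/existsNP[A /not_implyP[TA nYA]]
                           /existsNP[B /not_implyP[TB nZB]]].
have [d [f [pf f0 fA]]] := sepY A (Tu _ TA) nYA.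
have [e [g [pg g0 gB]]] := sepZ B (Tu _ TB) nZB.
have [qf _ fE] := polyfun_line A (B - A) pf.
have [qg _ gE] := polyfun_line A (B - A) pg.
have [qd _ dE] := polyfun_line A (B - A) (@polyfun_det C).
have qf0 : qf != 0.
  by apply: contraNneq fA => q0; rewrite -[A]addr0 -(scale0r (B - A)) fE q0 horner0.
have qg0 : qg != 0.
  apply: contraNneq gB => q0.
  by rewrite -[B](subrK A) addrC -[B - A]scale1r gE q0 horner0.
have qd0 : qd != 0.
  apply: contraTneq (Tu _ TA) => q0.
  by rewrite unitmxE unitfE -[A]addr0 -(scale0r (B - A)) dE q0 horner0 eqxx.
have /closed_nonrootP[s] := mulf_neq0 (mulf_neq0 qf0 qg0) qd0.
rewrite !rootM !negb_or /root -fE -gE -dE => /andP[/andP[fs gs] ds].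
have [|/f0/eqP|/g0/eqP] := TYZ (A + s *: (B - A)).
- by apply: lineT => //; rewrite unitmxE unitfE.
- exact/negP.
- exact/negP.
Qed.

Definition scalar_torus : set 'M[C]_2 := [set A | exists2 c, c != 0 & A = c%:M].
Definition diagonal_torus : set 'M[C]_2 :=
  [set A | exists a b, [/\ a != 0, b != 0 & A = mx2 a 0 0 b]].

Lemma bounded_by_functions X (fs : seq ('M[C]_2 -> C)) :
  (forall i, (i < size fs)%N -> polyfun 2 (nth (fun=> 0) fs i)) ->
  (forall A, X A <-> A \in unitmx /\
     forall i, (i < size fs)%N -> nth (fun=> 0) fs i A = 0) ->
  bounded_by 6 X.
Proof.
move=> pfs XE; apply: bounded_byP => [A /XE[]//|A Au fA].
apply/XE; split=> // i ifs; apply: fA => [|B /XE[_]]; last exact.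
exact: polyfun_leq (pfs i ifs).
Qed.

Lemma polyfun_entry2 i j : polyfun 2 (fun A : 'M[C]_2 => A i j).
Proof. exact: polyfun_leq (polyfun_entry C i j). Qed.

Lemma polyfun_entries2 i j k l : polyfun 2 (fun A : 'M[C]_2 => A i j * A k l).
Proof. exact: (polyfunM (polyfun_entry C i j) (polyfun_entry C k l)). Qed.

Lemma diagonal_torus_bounded : bounded_by 6 diagonal_torus.
Proof.
apply: (@bounded_by_functions _ [:: (fun A => A 0 1); (fun A => A 1 0)]).
  by move=> [|[|]] //= _; apply: polyfun_entry2.
move=> A; split=> [[a [b [a0 b0 ->]]]|[+ A0]].
  rewrite unit_mx2 mulr0 subr0 mulf_neq0 //; split=> // -[|[|]] //= _; by rewrite mxE.
have A01 : A 0 1 = 0 := A0 0%N isT; have A10 : A 1 0 = 0 := A0 1%N isT.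
rewrite (mx2E A) A01 A10 unit_mx2 mulr0 subr0 mulf_eq0 negb_or.
by move=> /andP[a0 b0]; exists (A 0 0), (A 1 1).
Qed.

Lemma scalar_torus_bounded : bounded_by 6 scalar_torus.
Proof.
apply: (@bounded_by_functions _
  [:: (fun A => A 0 1); (fun A => A 1 0); (fun A => A 0 0 - A 1 1)]).
  by move=> [|[|[|]]] //= _; do ?[apply: polyfunB]; apply: polyfun_entry2.
move=> A; split=> [[a a0 ->]|[+ A0]].
  rewrite scalar_mx2 unit_mx2 mulr0 subr0 mulf_neq0 //; split=> // -[|[|[|]]] //= _;
    by rewrite !mxE ?subrr.
have A01 : A 0 1 = 0 := A0 0%N isT; have A10 : A 1 0 = 0 := A0 1%N isT.
have /eqP : A 0 0 - A 1 1 = 0 := A0 2%N isT; rewrite subr_eq0 => /eqP A0011.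
rewrite (mx2E A) A01 A10 A0011 unit_mx2 mulr0 subr0 mulf_eq0 orbb.
by move=> a0; exists (A 1 1); rewrite ?scalar_mx2.
Qed.

Lemma diag_diagonalizable (a b : C) : diagonalizable (mx2 a 0 0 b).
Proof.
apply/diagonalizableE; exists 1%:M; first exact: unitmx1.
rewrite mul1mx -[X in invmx X]/(1%:M) invmx1 mulmx1.
by apply/is_diag_mxP => -[[|[|i]] ?] [[|[|j]] ?] //; rewrite !mxE.
Qed.

Lemma diagonal_torus_torus : torus diagonal_torus.
Proof.
apply: linear_torus.
- apply/algebraic_groupP; split.
    exact: bounded_zariski_closed diagonal_torus_bounded.
  split.
  + by move=> A [a [b [a0 b0 ->]]]; rewrite unit_mx2 mulr0 subr0 mulf_neq0.
  + by exists 1, 1; rewrite oner_eq0 scalar_mx2.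
  + move=> A B [a [b [a0 b0 ->]]] [c [d [c0 d0 ->]]]; exists (a * c), (b * d).
    by rewrite !mulf_neq0 // mx2M; split=> //; congr mx2; ring.
  + move=> A [a [b [a0 b0 ->]]]; exists a^-1, b^-1; rewrite !invr_eq0; split=> //.
    rewrite invmx_mx2 ?mulr0 ?subr0 ?mulf_neq0 // mx2Z.
    by congr mx2; try (by rewrite oppr0 mulr0); field; rewrite a0 b0.
- move=> A B [a [b [_ _ ->]]] [c [d [_ _ ->]]]; rewrite !mx2M; congr mx2; ring.
- by move=> A [a [b [_ _ ->]]]; exact: diag_diagonalizable.
- move=> A B s [a [b [_ _ ->]]] [c [d [_ _ ->]]].
  rewrite -scaleN1r !(mx2Z, mx2D) !(mulr0, addr0) unit_mx2 mulr0 subr0 mulf_eq0 negb_or.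
  by move=> /andP[x0 y0]; eexists; eexists; split; last reflexivity.
Qed.

Lemma scalar_torus_torus : torus scalar_torus.
Proof.
have sub A : scalar_torus A -> diagonal_torus A.
  by move=> [a a0 ->]; exists a, a; rewrite scalar_mx2.
have [_ commD _ diagD] := diagonal_torus_torus.
apply: linear_torus.
- apply/algebraic_groupP; split.
    exact: bounded_zariski_closed scalar_torus_bounded.
  split.
  + by move=> A [c c0 ->]; rewrite scalar_mx2 unit_mx2 mulr0 subr0 mulf_neq0.
  + by exists 1; rewrite ?oner_eq0.
  + by move=> A B [c c0 ->] [d d0 ->]; exists (c * d); rewrite ?mulf_neq0 // -scalar_mxM.
  + by move=> A [c c0 ->]; exists c^-1; rewrite ?invr_eq0 // invmx_scalar.
- by move=> A B /sub TA /sub TB; exact: commD.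
- by move=> A /sub; exact: diagD.
- move=> A B s [c c0 ->] [d d0 ->].
  rewrite -raddfB /= scale_scalar_mx -raddfD /=; set x := c + _ => xu.
  by exists x => //; move: xu; rewrite scalar_mx2 unit_mx2 mulr0 subr0 mulf_eq0 orbb.
Qed.

End Tori.

(** * Triangular and monomial groups *)

Section Envelopes.
Local Open Scope classical_set_scope.
Local Open Scope ring_scope.

Variables (C : closedFieldType) (charC : [pchar C] =i pred0).
Implicit Types (A B P : 'M[C]_2) (T X G H K : set 'M[C]_2).

Definition has_bounded_envelope G := exists H, toric_envelope H G /\ bounded_by 6 H.

Lemma bounded_envelope_intro G H T : torus T -> matrix_group H -> bounded_by 6 H ->
  (forall A, T A -> H A) -> (forall A, G A -> H A) ->
  (forall A, H A -> exists2 t, T t & exists2 g, G g & A = t *m g) ->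
  has_bounded_envelope G.
Proof.
move=> tT gH bH TH GH HTG; exists H; split=> //; split.
  by apply/algebraic_groupP; split=> //; exact: bounded_zariski_closed bH.
exists T; split=> //; have [_ _ HM _] := gH; apply/seteqP; split=> A /=.
  by move=> /HTG[t Tt [g Gg ->]]; exists t => //; exists g.
by move=> [t Tt [g Gg <-]]; apply: HM; [exact: TH | exact: GH].
Qed.

Lemma bounded_envelope_conj P G : P \in unitmx ->
  has_bounded_envelope (conj_set P G) -> has_bounded_envelope G.
Proof.
move=> Pu [H [[aH [T [tT HE]]] bH]]; have Vu : invmx P \in unitmx by rewrite unitmx_inv.
exists (conj_set (invmx P) H); split; last exact: bounded_by_conj.
split; first exact: algebraic_group_conj.
exists (conj_set (invmx P) T); split; first exact: torus_conj.
have conjVE A : invmx P *m A *m invmx (invmx P) = invmx P *m A *m P by rewrite invmxK.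
apply/seteqP; split=> A; rewrite /conj_set /= conjVE.
  rewrite HE => -[t Tt [g Gg tgA]]; exists (P *m t *m invmx P).
    by rewrite /= invmxK conj_mulmxVK.
  by exists (P *m g *m invmx P) => //; rewrite -conj_mulmx // tgA conj_mulmxK.
move=> [t Tt [g Gg <-]]; rewrite HE; exists (invmx P *m t *m P).
  by move: Tt; rewrite /= invmxK.
exists (invmx P *m g *m P); first by rewrite /conj_set /= conj_mulmxK.
by rewrite !mulmxA mulmxK.
Qed.

Definition upper_triangular : set 'M[C]_2 := [set A | A \in unitmx /\ A 1 0 = 0].

Lemma upper_triangularP A : upper_triangular A <->
  exists a b d, [/\ a != 0, d != 0 & A = mx2 a b 0 d].
Proof.
split=> [[+ A0]|[a [b [d [a0 d0 ->]]]]].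
  rewrite (mx2E A) A0 unit_mx2 mulr0 subr0 mulf_eq0 negb_or => /andP[a0 d0].
  by exists (A 0 0), (A 0 1), (A 1 1).
by split; rewrite ?unit_mx2 ?mulr0 ?subr0 ?mulf_neq0 // mxE.
Qed.

Lemma upper_triangular_bounded : bounded_by 6 upper_triangular.
Proof.
apply: (@bounded_by_functions _ _ [:: (fun A => A 1 0)]).
  by move=> [|] //= _; apply: polyfun_entry2.
move=> A; split=> [[Au A0]|[Au A0]]; first by split=> // -[|].
by split=> //; exact: (A0 0%N isT).
Qed.

Lemma upper_triangular_group : matrix_group upper_triangular.
Proof.
split=> [A []//||A B|A].
- by apply/upper_triangularP; exists 1, 0, 1; rewrite oner_eq0 scalar_mx2.
- move=> /upper_triangularP[a [b [d [a0 d0 ->]]]] /upper_triangularP[x [y [z [x0 z0 ->]]]].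
  apply/upper_triangularP; exists (a * x), (a * y + b * z), (d * z).
  by rewrite !mulf_neq0 // mx2M; split=> //; congr mx2; ring.
- move=> /upper_triangularP[a [b [d [a0 d0 ->]]]]; apply/upper_triangularP.
  exists a^-1, (- b / (a * d)), d^-1; rewrite !invr_eq0; split=> //.
  rewrite invmx_mx2 ?mulr0 ?subr0 ?mulf_neq0 // mx2Z.
  by congr mx2; try (by rewrite oppr0 mulr0); field; rewrite a0 d0.
Qed.

(** The group of monomial matrices, the normalizer of the diagonal torus. *)
Definition monomial_mxs : set 'M[C]_2 := [set A |
  diagonal_torus A \/ exists a b, [/\ a != 0, b != 0 & A = mx2 0 a b 0]].

Lemma monomial_mxs_unit A : monomial_mxs A -> A \in unitmx.
Proof.
move=> [|] [a [b [a0 b0 ->]]].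
  by rewrite unit_mx2 mulr0 subr0 mulf_neq0.
by rewrite unit_mx2 mul0r sub0r oppr_eq0 mulf_neq0.
Qed.

Lemma monomial_mxs_bounded : bounded_by 6 monomial_mxs.
Proof.
apply: (@bounded_by_functions _ _
  [:: (fun A => A 0 0 * A 0 1); (fun A => A 0 0 * A 1 0);
      (fun A => A 1 1 * A 0 1); (fun A => A 1 1 * A 1 0)]).
  by move=> [|[|[|[|]]]] //= _; apply: polyfun_entries2.
move=> A; split=> [mA|[Au A0]].
  split=> [|i]; first exact: monomial_mxs_unit.
  by case: mA => -[a [b [_ _ ->]]]; case: i => [|[|[|[|]]]] //= _;
    rewrite !mxE /= ?mulr0 ?mul0r.
have E1 : A 0 0 * A 0 1 = 0 := A0 0%N isT; have E2 : A 0 0 * A 1 0 = 0 := A0 1%N isT.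
have E3 : A 1 1 * A 0 1 = 0 := A0 2%N isT; have E4 : A 1 1 * A 1 0 = 0 := A0 3%N isT.
move: Au E1 E2 E3 E4 {A0}; rewrite [in X in X -> _](mx2E A) [in monomial_mxs _](mx2E A).
move: (A 0 0) (A 0 1) (A 1 0) (A 1 1) => a b c d.
rewrite unit_mx2; have [->|a0] := eqVneq a 0.
  rewrite mul0r sub0r oppr_eq0 mulf_eq0 negb_or => /andP[b0 c0] _ _ /eqP.
  by rewrite mulf_eq0 (negbTE b0) orbF => /eqP-> _; right; exists b, c.
move=> + /eqP + /eqP; rewrite !mulf_eq0 (negbTE a0) /= => det0 /eqP b0 /eqP c0.
move: det0; rewrite b0 c0 mul0r subr0 mulf_eq0 (negbTE a0) /= => d0 _ _.
by left; exists a, d.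
Qed.

Lemma monomial_mxs_group : matrix_group monomial_mxs.
Proof.
split.
- exact: monomial_mxs_unit.
- by left; exists 1, 1; rewrite oner_eq0 scalar_mx2.
- move=> A B [|] [a [b [a0 b0 ->]]] [|] [c [d [c0 d0 ->]]]; rewrite mx2M;
    rewrite !(mulr0, mul0r, addr0, add0r).
  + by left; exists (a * c), (b * d); rewrite !mulf_neq0.
  + by right; exists (a * c), (b * d); rewrite !mulf_neq0.
  + by right; exists (a * d), (b * c); rewrite !mulf_neq0.
  + by left; exists (a * d), (b * c); rewrite !mulf_neq0.
- move=> A [|] [a [b [a0 b0 ->]]].
    left; exists a^-1, b^-1; rewrite !invr_eq0; split=> //.
    rewrite invmx_mx2 ?mulr0 ?subr0 ?mulf_neq0 // mx2Z.
    by congr mx2; try (by rewrite oppr0 mulr0); field; rewrite a0 b0.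
  right; exists b^-1, a^-1; rewrite !invr_eq0; split=> //.
  rewrite invmx_mx2 ?mul0r ?sub0r ?oppr_eq0 ?mulf_neq0 // mx2Z.
  by congr mx2; try (by rewrite mulr0); field; rewrite ?oppr_eq0 ?mulf_neq0 ?a0 ?b0.
Qed.

Lemma diagonal_envelope G : matrix_group G -> (forall A, G A -> diagonal_torus A) ->
  has_bounded_envelope G.
Proof.
move=> [_ G1 _ _] GD; have tD := diagonal_torus_torus C.
apply: (@bounded_envelope_intro G (@diagonal_torus C) _ tD) => //.
- by have [/algebraic_groupP[_ gD] _ _ _] := tD.
- exact: diagonal_torus_bounded.
- by move=> A DA; exists A => //; exists 1%:M; rewrite ?mulmx1.
Qed.

(** For [a] not a root of unity, a polynomial relation between [a ^+ k] and [k] is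
    trivial; otherwise some power of the given matrix is unipotent. *)
Lemma unipotents_up_to_scalars G (a b : C) : matrix_group G -> zariski_closed G ->
  b != 0 -> G (mx2 a b 0 a) ->
  forall s, exists2 c, c != 0 & G (c *: mx2 1 s 0 1).
Proof.
move=> [Gu G1 GM _] cG b0 Gab s; exists 1; rewrite ?oner_neq0 // scale1r.
have a0 : a != 0 by have := Gu _ Gab; rewrite unit_mx2 mulr0 subr0 mulf_eq0 orbb.
have ba0 : b / a != 0 by rewrite mulf_neq0 ?invr_eq0.
pose E : 'M[C]_2 := mx2 0 1 0 0.
have lineE x : 1%:M + x *: E = mx2 1 x 0 1.
  by rewrite scalar_mx2 mx2Z mx2D; congr mx2; ring.
have Gk (k : nat) : G (a ^+ k *: (1%:M + (k%:R * (b / a)) *: E)).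
  elim: k => [|k IHk]; first by rewrite mul0r scale0r addr0 scale1r.
  have -> : a ^+ k.+1 *: (1%:M + (k.+1%:R * (b / a)) *: E) =
      (a ^+ k *: (1%:M + (k%:R * (b / a)) *: E)) *m mx2 a b 0 a.
    rewrite !lineE !mx2Z mx2M exprS -natr1.
    by congr mx2; field.
  exact: GM.
apply: (zariski_closed_vanish cG) => [|d f pf f0].
  by rewrite unit_mx2 mulr1 mulr0 subr0 oner_eq0.
have [q _ fE] := polyfun_scaled_line 1%:M E pf.
have sum0 k : \sum_(j < d.+1) (a ^+ j) ^+ k * (q j).[k%:R * (b / a)] = 0.
  have := f0 _ (Gk k); rewrite fE => E0; rewrite -[RHS]E0.
  by apply: eq_bigr => j _; rewrite -!exprM mulnC.
rewrite -lineE -[1%:M + _]scale1r fE.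
have [[m m0 am]|not_root] := pselect (exists2 m, (0 < m)%N & a ^+ m = 1).
  under eq_bigr => j _ do rewrite expr1n mul1r.
  rewrite -horner_sum (_ : \sum_j q j = 0) ?horner0 //.
  have mba0 : m%:R * (b / a) != 0.
    by rewrite mulf_neq0 // ((pcharf0P C).1 charC) -lt0n.
  apply: (poly_eq0_on_multiples charC mba0) => k.
  rewrite horner_sum -[RHS](sum0 (k * m)%N); apply: eq_bigr => j _.
  by rewrite natrM mulrA exprAC mulnC exprM am !expr1n mul1r.
pose p j := q j \Po ((b / a) *: 'X).
have p0 : forall j, p j = 0.
  apply: (exponential_polynomial_independence charC (l := fun j : 'I_d.+1 => a ^+ j)).
  - move=> i j; wlog ij : i j / (i < j)%N => [W|].
      case: (ltngtP i j) => [ij|ji|ij] aij; [exact: W|by apply/esym/W|exact: val_inj].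
    move=> aij; case: not_root; exists (j - i)%N; first by rewrite subn_gt0.
    by apply: (mulfI (expf_neq0 i a0)); rewrite -exprD subnKC ?mulr1 // ltnW.
  - by move=> j; exact: expf_neq0.
  - move=> k; rewrite -[RHS](sum0 k); apply: eq_bigr => j _.
    by rewrite /p horner_comp hornerZ hornerX [b / a * _]mulrC.
apply: big1 => j _; have /(congr1 (fun r => r.[s / (b / a)])) := p0 j.
by rewrite /p horner_comp hornerZ hornerX horner0 mulrC divfK // => ->; rewrite mulr0.
Qed.

(** If [G] contains a nonscalar matrix with a single eigenvalue, it contains all
    unipotent matrices up to scalars, and the diagonal torus completes it to the whole
    triangular group. Otherwise it has no unipotent element besides the identity, so
    all commutators are trivial and [G] lies in a torus. *)
Lemma triangular_envelope G : algebraic_group G ->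
  (forall A, G A -> upper_triangular A) -> has_bounded_envelope G.
Proof.
move=> /algebraic_groupP[cG gG] GB; have [Gu G1 GM GV] := gG.
have [[a [b [b0 Gab]]]|no_unip] := pselect (exists a b, b != 0 /\ G (mx2 a b 0 a)).
  have GU := unipotents_up_to_scalars gG cG b0 Gab.
  apply: (bounded_envelope_intro (diagonal_torus_torus C) upper_triangular_group
            upper_triangular_bounded) => //.
    move=> A [x [y [x0 y0 ->]]]; apply/upper_triangularP; by exists x, 0, y.
  move=> A /upper_triangularP[x [y [z [x0 z0 ->]]]].
  have [c c0 Gc] := GU (y / x).
  exists (mx2 (x / c) 0 0 (z / c)).
    by exists (x / c), (z / c); rewrite !mulf_neq0 ?invr_eq0.
  exists (c *: mx2 1 (y / x) 0 1) => //.
  by rewrite mx2Z mx2M; congr mx2; field; rewrite ?x0 ?c0.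
have Gaa x y : G (mx2 x y 0 x) -> y = 0.
  by move=> Gxy; apply: contrapT => /eqP y0; apply: no_unip; exists x, y.
have Gcomm A B : G A -> G B -> A *m B = B *m A.
  move=> GA GB'; have /upper_triangularP[a [b [d [a0 d0 AE]]]] := GB _ GA.
  have /upper_triangularP[x [y [z [x0 z0 BE]]]] := GB _ GB'.
  have BAu : B *m A \in unitmx by rewrite unitmx_mul !Gu.
  have G' : G (A *m B *m invmx (B *m A)) by apply: (GM); [exact: GM | apply/GV/GM].
  have quotE : exists w, A *m B *m invmx (B *m A) = mx2 1 w 0 1.
    exists (((a * y + b * z) - (x * b + y * d)) / (d * z)).
    apply: (can_inj (mulmxK BAu)); rewrite mulmxKV // AE BE !mx2M.
    by congr mx2; field; rewrite ?d0 ?z0.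
  have [w wE] := quotE; move: G'; rewrite wE => /Gaa w0.
  rewrite -[A *m B](mulmxKV BAu) wE w0 -scalar_mx2 mul1mx //.
have [Gsc|nGsc] := pselect (forall A, G A -> is_scalar_mx A).
  apply: (@bounded_envelope_intro G (@scalar_torus C) _ (scalar_torus_torus C)) => //.
  - by have [/algebraic_groupP[_ gZ] _ _ _] := scalar_torus_torus C.
  - exact: scalar_torus_bounded.
  - move=> A GA; have /is_scalar_mxP[c AE] := Gsc A GA; exists c => //.
    by have := Gu _ GA; rewrite AE scalar_mx2 unit_mx2 mulr0 subr0 mulf_eq0 orbb.
  - by move=> A ZA; exists A => //; exists 1%:M; rewrite ?mulmx1.
have [g [Gg nscg]] : exists g, G g /\ ~~ is_scalar_mx g.
  apply: contrapT => no; apply: nGsc => A GA; apply: contraT => nsc.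
  by case: no; exists A.
have [P Pu [[a [b [ab gE]]]|[a [b [b0 gE]]]]] := nonscalar_normal_form nscg; last first.
  (* A repeated eigenvalue forces the diagonal entries to agree. *)
  have /upper_triangularP[x [y [z [x0 z0 gE']]]] := GB _ Gg.
  have trE := congr1 mxtrace gE; have detE := congr1 determinant gE.
  move: trE detE; rewrite mxtrace_conj // det_conj // gE' !mxtrace_mx2 !det_mx2.
  move=> trE detE; have : (x - z) ^+ 2 = 0.
    have -> : (x - z) ^+ 2 = (x + z) ^+ 2 - 4%:R * (x * z - y * 0) by ring.
    by rewrite trE detE; ring.
  move/eqP; rewrite expf_eq0 /= subr_eq0 => /eqP xz.
  by move: nscg Gg; rewrite gE' xz => nscg /Gaa y0;
    rewrite y0 is_scalar_mx2 !eqxx in nscg.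
apply: (bounded_envelope_conj Pu).
apply: diagonal_envelope; first exact: matrix_group_conj.
move=> A GA; have Au : A \in unitmx by rewrite -(conj_unitmx _ Pu); exact: Gu.
have := Gcomm _ _ GA Gg; rewrite gE -!conj_mulmx // => /(congr1 (fun M => invmx P *m M *m P)).
rewrite !conj_mulmxVK //; have [x [y [z [t AE]]]] := mx2P A; rewrite AE !mx2M.
have commute_eq0 (u : C) : u * b = a * u -> u = 0.
  move=> /eqP; rewrite [a * u]mulrC -subr_eq0 -mulrBr mulf_eq0 subr_eq0.
  by rewrite [b == a]eq_sym (negbTE ab) orbF => /eqP.
case/mx2_inj => _ E1 E2 _.
have y0 : y = 0 by apply: commute_eq0; move: E1; rewrite !mulr0 !mul0r !add0r addr0.
have z0 : z = 0.
  by apply: commute_eq0; move: E2; rewrite !mulr0 !mul0r !add0r addr0 [b * z]mulrC [z * a]mulrC.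
move: Au; rewrite AE y0 z0 unit_mx2 mulr0 subr0 mulf_eq0 negb_or => /andP[x0 t0].
by exists x, t.
Qed.

(** Any monomial matrix that is not diagonal, together with the diagonal torus,
    generates all the monomial matrices. *)
Lemma imprimitive_envelope G : algebraic_group G -> ~ primitive G ->
  has_bounded_envelope G.
Proof.
move=> aG nprG; have /algebraic_groupP[cG gG] := aG; have [Gu G1 _ _] := gG.
have [O [O0 O2 Oinv]] : exists O : seq (option C),
    [/\ O != [::], (size O <= 2)%N & mobius_invariant G O].
  apply: contrapT => no; apply: nprG => O O0 O2; apply: contrapT => no'.
  apply: no; exists O; split=> // A p GA pO; apply: contraT => ApO.
  by case: no'; exists A, p.
have one_point p : mobius_invariant G [:: p] -> has_bounded_envelope G.
  move=> pinv; pose q : option C := if p is Some _ then None else Some 0.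
  have pq : p != q by rewrite /q; case: (p).
  have Pu := basis_mx_unit pq; apply: (bounded_envelope_conj Pu).
  apply: triangular_envelope; first exact: algebraic_group_conj.
  move=> A GA; have Au : A \in unitmx by rewrite -(conj_unitmx _ Pu); exact: Gu.
  split=> //; apply/eqP; rewrite -mobius_None_None //.
  rewrite -[A](conj_mulmxVK _ Pu) mobius_conj ?conj_unitmx // mobius_basis_None.
  have := pinv _ p GA; rewrite !inE eqxx => /(_ isT)/eqP->.
  by rewrite -{2}(mobius_basis_None p q) mobiusK.
case: O O0 O2 Oinv => [//|p [|q [|//]]] _ _ Oinv; first exact: (one_point p).
have [pq|pq] := eqVneq p q.
  apply: (one_point p) => A x GA xp; have := Oinv A x GA.
  by move: xp; rewrite pq !inE orbb => -> /(_ isT); rewrite orbb.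
have Pu := basis_mx_unit pq; apply: (bounded_envelope_conj Pu).
have gG' := matrix_group_conj Pu gG.
have Gmono A : conj_set (basis_mx p q) G A -> monomial_mxs A.
  move=> GA; have Au : A \in unitmx by rewrite -(conj_unitmx _ Pu); exact: Gu.
  have Ainv x : x \in [:: None; Some 0] -> mobius A x \in [:: None; Some 0].
    have basis_in y : (mobius (basis_mx p q) y \in [:: p; q]) = (y \in [:: None; Some 0]).
      have NoneE := inj_eq (mobius_inj Pu) y None.
      have Some0E := inj_eq (mobius_inj Pu) y (Some 0).
      by rewrite !inE -NoneE -Some0E mobius_basis_None mobius_basis_Some0.
    rewrite -!basis_in => /(Oinv _ _ GA).
    by rewrite !mobiusM ?unitmx_mul ?unitmx_inv ?Pu // mobiusK.
  have in0 : Some 0 \in [:: None; Some (0 : C)] by rewrite !inE eqxx orbT.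
  have := Ainv None (mem_head _ _); have := Ainv _ in0.
  rewrite !inE mobius_None_None // mobius_None_Some0 // mobius_Some0_None //.
  rewrite mobius_Some0_Some0 //.
  move: Au; have [a [b [c [d ->]]]] := mx2P A; rewrite unit_mx2 !mxE /=.
  case/boolP: (d == 0) => [/eqP-> +|d0] /=.
    rewrite mulr0 sub0r oppr_eq0 mulf_eq0 negb_or => /andP[b0 c0] _.
    by rewrite (negbTE c0) => /eqP->; right; exists b, c.
  move=> det0 /eqP b0; move: det0; rewrite b0.
  rewrite mul0r subr0 mulf_eq0 negb_or => /andP[a0 _].
  by rewrite (negbTE a0) orbF => /eqP->; left; exists a, d.
have [GD|] := pselect (forall A, conj_set (basis_mx p q) G A -> diagonal_torus A).
  exact: diagonal_envelope.
move=> /existsNP[w /not_implyP[Gw nDw]].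
have [//|[x [y [x0 y0 wE]]]] := Gmono w Gw.
apply: (bounded_envelope_intro (diagonal_torus_torus C) monomial_mxs_group
          monomial_mxs_bounded) => // [A DA|A]; first by left.
have [_ G1' _ _] := gG'.
move=> [DA|[a [b [a0 b0 ->]]]]; first by exists A => //; exists 1%:M; rewrite ?mulmx1.
exists (mx2 (a / x) 0 0 (b / y)).
  by exists (a / x), (b / y); rewrite !mulf_neq0 ?invr_eq0.
exists w => //; rewrite wE mx2M.
by congr mx2; rewrite ?(mulr0, mul0r, addr0, add0r) ?divfK.
Qed.

End Envelopes.

(** * Primitive groups *)

Section PrimitiveEnvelope.
Local Open Scope classical_set_scope.
Local Open Scope ring_scope.

Variables (C : closedFieldType) (charC : [pchar C] =i pred0).
Implicit Types (A B P : 'M[C]_2) (T X G H K : set 'M[C]_2).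

Definition cone G : set 'M[C]_2 :=
  [set A | exists2 c, c != 0 & exists2 g, G g & A = c *: g].

Lemma sub_cone G A : G A -> cone G A.
Proof. by move=> GA; exists 1; rewrite ?oner_neq0 //; exists A; rewrite ?scale1r. Qed.

Lemma cone_group_cone G : matrix_group G -> cone_group (cone G).
Proof.
move=> [Gu G1 GM GV]; split; last first.
  by move=> c c0; exists c => //; exists 1%:M; rewrite ?scalemx1.
split; first 2 last.
- move=> A B [c c0 [g Gg ->]] [d d0 [h Gh ->]]; exists (c * d); first exact: mulf_neq0.
  by exists (g *m h); [exact: GM | rewrite -scalemxAl -scalemxAr scalerA].
- move=> A [c c0 [g Gg ->]]; have gu := Gu _ Gg.
  exists c^-1; first by rewrite invr_eq0.
  exists (invmx g); [exact: GV | rewrite invmxZ //].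
  by rewrite unitmxZ // unitfE.
- by move=> A [c c0 [g Gg ->]]; rewrite unitmxZ ?unitfE //; exact: Gu.
- exact: sub_cone.
Qed.

Lemma primitive_sub K X : (forall A, K A -> X A) -> primitive K -> primitive X.
Proof.
move=> KX prK O O0 O2; have [A [p [KA pO ApO]]] := prK O O0 O2.
by exists A, p; split=> //; exact: KX.
Qed.

Lemma polyfun_adj (i j : 'I_2) : polyfun 1 (fun A : 'M[C]_2 => (\adj A) i j).
Proof.
apply: (@polyfun_ext _ _ _ (fun A : 'M[C]_2 =>
    (-1) ^+ (j + i) * A (lift j 0) (lift i 0))) => [A|].
  by rewrite mxE /cofactor det_mx11 !mxE.
by apply/polyfunZ/polyfun_entry.
Qed.

(** In size two the adjugate is linear, so that inversion preserves, up to scalars,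
    the degree of polynomial functions. *)
Lemma cone_group_clos d K : cone_group K -> cone_group (clos d K).
Proof.
move=> gK; have [[Ku K1 KM KV] cK] := gK.
have Ksub A : K A -> clos d K A by exact: sub_clos.
split; last by move=> c /cK/Ksub.
split=> [A []//||A B clA clB|A clA]; first exact: Ksub.
  split=> [|f pf f0]; first by rewrite unitmx_mul (clos_unit clA) (clos_unit clB).
  rewrite -[A *m B]mulmx1; have [_ clB'] := clB; apply: (clB' (fun M => f (A *m M *m 1%:M))).
    exact: polyfun_mulmx.
  move=> h Kh; rewrite -[A]mul1mx mulmx1; have [_ clA'] := clA.
  apply: (clA' (fun M => f (1%:M *m M *m h))); first exact: polyfun_mulmx.
  by move=> g Kg; rewrite mul1mx; apply/f0/KM.
have Au := clos_unit clA; have [_ clA'] := clA.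
split=> [|f pf f0]; first by rewrite unitmx_inv.
have dA0 : \det A != 0 by rewrite -unitfE -unitmxE.
pose phi (M : 'M[C]_2) := (\det A)^-1 *: \adj M.
have -> : invmx A = phi A by rewrite /phi /invmx Au.
apply: (clA' (fun M => f (phi M))).
  rewrite -[d]mul1n; apply: (polyfun_comp pf) => i j.
  apply: (@polyfun_ext _ _ _ (fun M : 'M[C]_2 => (\det A)^-1 * (\adj M) i j)).
    by move=> M; rewrite [in RHS]mxE.
  exact/polyfunZ/polyfun_adj.
move=> g Kg; apply: f0; apply: cone_groupZ => //; first by rewrite invr_eq0.
have gu := Ku _ Kg; have dg0 : \det g != 0 by rewrite -unitfE -unitmxE.
have -> : \adj g = \det g *: invmx g by rewrite /invmx gu scalerA mulfV // scale1r.
by apply: cone_groupZ => //; exact: KV.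
Qed.

Lemma clos_stable_clos d K : clos_stable d (clos d K).
Proof. by move=> A; exact: clos_idem. Qed.

Lemma finite_mod_scalars_sub K X : (forall A, K A -> X A) ->
  finite_mod_scalars X -> finite_mod_scalars K.
Proof.
by move=> KX [M XM]; exists M => s sK; apply: XM => A /sK/KX.
Qed.

Lemma clos_primitive_dichotomy d K : cone_group K -> primitive K ->
  full (clos d K) \/ finite_mod_scalars (clos d K).
Proof.
move=> gK prK; have [[Ku _ _ _] _] := gK; have gX := cone_group_clos d gK.
have prX : primitive (clos d K).
  by apply: (primitive_sub _ prK) => A; exact: sub_clos.
have [|bounded] := primitive_dichotomy charC gX (@clos_stable_clos d K) prX.
  by left.
by right; exact: (bounded_order_finite charC gX.1 bounded).
Qed.

Lemma polyfun_mulmx_entries k l (phi psi : 'M[C]_2 -> 'M[C]_2) :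
  (forall i j, polyfun k (fun A => phi A i j)) ->
  (forall i j, polyfun l (fun A => psi A i j)) ->
  forall i j, polyfun (k + l) (fun A => (phi A *m psi A) i j).
Proof.
move=> pphi ppsi i j.
apply: (@polyfun_ext _ _ _ (fun A => \sum_m phi A i m * psi A m j)).
  by move=> A; rewrite mxE.
by apply: polyfun_sum => m _; exact: polyfunM.
Qed.

(** Multiplying by a power of the determinant turns the rational function into a
    polynomial one, to which density applies; its degree grows with [d], which is why
    density is needed in every degree. *)
Lemma vanishes_of_full_clos K d f (phi : 'M[C]_2 -> 'M[C]_2) :
  (forall d, full (clos d K)) -> (forall A, K A -> A \in unitmx) -> polyfun d f ->
  (forall i j, polyfun 2 (fun A => phi A i j)) ->
  (forall A, K A -> f ((\det A)^-1 *: phi A) = 0) ->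
  forall A, A \in unitmx -> f ((\det A)^-1 *: phi A) = 0.
Proof.
move=> fullK Ku pf pphi f0 A Au.
have [F pF FE] := polyfun_comp_frac pf pphi (polyfun_det C).
have det0 B : B \in unitmx -> \det B != 0 by rewrite unitmxE unitfE.
have F0 : vanishes F K.
  by move=> B KB; rewrite FE ?det0 ?Ku // f0 // mulr0.
have [_ clF] := fullK (2 * d)%N A Au; have := clF F pF F0.
rewrite FE ?det0 // => /eqP; rewrite mulf_eq0 expf_eq0 (negbTE (det0 _ Au)) andbF.
by move/eqP.
Qed.

(** A commutator does not change when its arguments are scaled, so that commutators
    of elements of [cone G] belong to [G], even though [cone G] is not known to be
    closed. Density extends this to all matrices, one argument at a time. *)
Lemma commutators_of_full_clos G : zariski_closed G -> matrix_group G ->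
  (forall d, full (clos d (cone G))) ->
  forall A B, A \in unitmx -> B \in unitmx -> G (A *m B *m invmx A *m invmx B).
Proof.
move=> cG gG fullG A B Au Bu; have [Gu _ GM GV] := gG.
have gK := cone_group_cone gG; have [[Ku _ _ _] _] := gK.
apply: (zariski_closed_vanish cG) => [|d f pf f0].
  by rewrite !unitmx_mul !unitmx_inv Au Bu.
have pId i j : polyfun 1 (fun M : 'M[C]_2 => M i j) by exact: polyfun_entry.
have pCst (M : 'M[C]_2) i j : polyfun 0 (fun _ : 'M[C]_2 => M i j).
  exact: polyfun_const.
have comm_cone g h : cone G g -> cone G h -> f (g *m h *m invmx g *m invmx h) = 0.
  move=> [c c0 [x Gx ->]] [e e0 [y Gy ->]].
  have -> : c *: x *m (e *: y) *m invmx (c *: x) *m invmx (e *: y) =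
            x *m y *m invmx x *m invmx y.
    rewrite !invmxZ ?unitmxZ ?unitfE ?Gu //.
    rewrite -!(scalemxAl, scalemxAr) !scalerA.
    by rewrite (_ : _ * _ = 1) ?scale1r //; field; rewrite c0.
  by apply: f0; apply: (GM); [apply: (GM); [exact: GM|exact: GV]|exact: GV].
have comm_l h x : cone G h -> x \in unitmx -> f (x *m h *m invmx x *m invmx h) = 0.
  move=> Kh xu; pose phi (M : 'M[C]_2) := M *m h *m \adj M *m invmx h.
  have phiE M : M \in unitmx -> (\det M)^-1 *: phi M = M *m h *m invmx M *m invmx h.
    by move=> Mu; rewrite /invmx Mu /phi -!(scalemxAl, scalemxAr).
  rewrite -phiE //; apply: (vanishes_of_full_clos fullG Ku pf) => // [|M KM].
    apply: (@polyfun_mulmx_entries 2 0) => //.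
    apply: (@polyfun_mulmx_entries 1 1); last exact: polyfun_adj.
    exact: (@polyfun_mulmx_entries 1 0).
  by rewrite phiE ?Ku //; exact: comm_cone.
pose phi (M : 'M[C]_2) := A *m M *m invmx A *m \adj M.
have phiE M : M \in unitmx -> (\det M)^-1 *: phi M = A *m M *m invmx A *m invmx M.
  by move=> Mu; rewrite [in RHS]/invmx Mu Au /phi -scalemxAr /invmx Au.
rewrite -phiE //; apply: (vanishes_of_full_clos fullG Ku pf) => // [|M KM].
  apply: (@polyfun_mulmx_entries 1 1); last exact: polyfun_adj.
  apply: (@polyfun_mulmx_entries 1 0) => //.
  exact: (@polyfun_mulmx_entries 0 1).
by rewrite phiE ?Ku //; exact: comm_l.
Qed.

(** Elementary matrices are commutators with diagonal matrices. *)
Lemma cone_full_of_full_clos G : zariski_closed G -> matrix_group G ->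
  (forall d, full (clos d (cone G))) -> full (cone G).
Proof.
move=> cG gG fullG; have comm := commutators_of_full_clos cG gG fullG.
have two0 : (2%:R : C) != 0 by rewrite ((pcharf0P C).1 charC).
have Uu s : mx2 1 s 0 1 \in (@unitmx C 2).
  by rewrite unit_mx2 mulr1 mulr0 subr0 oner_eq0.
have Lu s : mx2 1 0 s 1 \in (@unitmx C 2).
  by rewrite unit_mx2 mulr1 mul0r subr0 oner_eq0.
have Du : mx2 2%:R 0 0 1 \in (@unitmx C 2) by rewrite unit_mx2 mulr1 mulr0 subr0.
have Du' : mx2 1 0 0 2%:R \in (@unitmx C 2) by rewrite unit_mx2 mul1r mulr0 subr0.
apply: full_of_elementary; first exact: cone_group_cone.
  move=> s; apply: sub_cone.
  have <- : mx2 2%:R 0 0 1 *m mx2 1 s 0 1 *m invmx (mx2 2%:R 0 0 1) *m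
            invmx (mx2 1 s 0 1) = mx2 1 s 0 1.
    apply: (can_inj (mulmxK (Uu s))); rewrite mulmxKV //.
    apply: (can_inj (mulmxK Du)); rewrite mulmxKV // !mx2M; congr mx2; ring.
  exact: comm.
move=> s; apply: sub_cone.
have <- : mx2 1 0 0 2%:R *m mx2 1 0 s 1 *m invmx (mx2 1 0 0 2%:R) *m
          invmx (mx2 1 0 s 1) = mx2 1 0 s 1.
  apply: (can_inj (mulmxK (Lu s))); rewrite mulmxKV //.
  apply: (can_inj (mulmxK Du')); rewrite mulmxKV // !mx2M; congr mx2; ring.
exact: comm.
Qed.

Lemma projective_order_sub K X N N' : (forall A, K A -> X A) -> cone_group K ->
  (forall A, X A -> A \in unitmx) -> projective_order K N -> projective_order X N' ->
  (N <= N')%N /\ ((N' <= N)%N -> forall A, X A -> K A).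
Proof.
move=> KX gK Xu [s [<- sK sP sC]] [s' [<- sX sP' sC']].
have [[Ku _ KM KV] cK] := gK.
have /choice[rep repP] A : exists B, X A -> B \in s' /\ proportional A B.
  have [XA|nXA] := pselect (X A); last by exists 0.
  by have [B Bs AB] := sC' A XA; exists B.
have rep_in A : A \in s -> rep A \in s' by move=> /sK/KX/repP[].
have rep_prop A : A \in s -> exists2 c, c != 0 & rep A = c *: A.
  move=> As; have [rs /proportionalP] := repP A (KX _ (sK _ As)).
  by apply; [exact/Ku/sK | exact/Xu/sX].
have uniq_rep : uniq (map rep s).
  rewrite uniq_pairwise pairwise_map.
  apply: (sub_in_pairwise (P := mem s)) sP; last by apply/allP.
  move=> A B As Bs /=; apply: contra => /eqP rAB.
  have [c c0 cE] := rep_prop A As; have [e e0 eE] := rep_prop B Bs.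
  apply/proportionalP; [exact/Ku/sK|exact/Ku/sK|].
  exists (e^-1 * c); first by rewrite mulf_neq0 // invr_eq0.
  by rewrite -scalerA -cE rAB eE scalerK.
have sub_rep : {subset map rep s <= s'} by move=> _ /mapP[A As ->]; exact: rep_in.
split; first by rewrite -(size_map rep); exact: uniq_leq_size.
rewrite -(size_map rep s) => le A XA.
have [_ rep_eq] := uniq_min_size uniq_rep sub_rep le.
have [B Bs' /proportionalP] := sC' A XA.
move=> /(_ (Xu _ XA) (Xu _ (sX _ Bs')))[c c0 BE].
move: Bs'; rewrite -rep_eq => /mapP[D Ds BD].
have [e e0 eE] := rep_prop D Ds.
apply: (cone_groupZK gK c0); rewrite -BE BD eE.
by apply: cone_groupZ => //; exact: sK.
Qed.

(** That the image of [p] under a matrix belongs to [O] is the vanishing of a product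
    of linear functions of the matrix, one for each point of [O]. *)
Lemma mobius_invariant_clos d K O : (forall A, K A -> A \in unitmx) ->
  (size O <= d)%N -> mobius_invariant K O -> mobius_invariant (clos d K) O.
Proof.
move=> Ku Od Oinv A p clA pO; have [Au fA] := clA.
pose f M := \prod_(q <- O) wedge (mulv M (vec_of_pt p)) (vec_of_pt q).
have f_in M : M \in unitmx -> (f M == 0) = (mobius M p \in O).
  move=> Mu; rewrite prodf_seq_eq0; apply/hasP/idP => [[q qO]|MpO].
    by rewrite andTb -mobius_eq // => /eqP->.
  by exists (mobius M p) => //=; rewrite -mobius_eq.
have pmulv (x y : C) i : polyfun 1 (fun M : 'M[C]_2 => M i 0 * x + M i 1 * y).
  apply: (@polyfun_ext _ _ _ (fun M : 'M[C]_2 => x * M i 0 + y * M i 1)).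
    by move=> M; rewrite ![M _ _ * _]mulrC.
  by apply: polyfunD; apply/polyfunZ/polyfun_entry.
have pf : polyfun d f.
  apply: (@polyfun_leq _ _ (\sum_(q <- O) 1)%N).
    by rewrite sum1_size.
  apply: polyfun_prod => q.
  apply: (@polyfun_ext _ _ _ (fun M : 'M[C]_2 =>
    (vec_of_pt q).2 * (M 0 0 * (vec_of_pt p).1 + M 0 1 * (vec_of_pt p).2) -
    (vec_of_pt q).1 * (M 1 0 * (vec_of_pt p).1 + M 1 1 * (vec_of_pt p).2))).
    by move=> M; rewrite /wedge /mulv /=; ring.
  by apply: polyfunB; apply/polyfunZ/pmulv.
rewrite -f_in //; apply/eqP; apply: fA => // g Kg; apply/eqP.
by rewrite f_in ?Ku //; exact: Oinv.
Qed.

(** Some nonzero sextic form vanishes on [K], so the closure is not everything; hence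
    it is finite modulo scalars, and its order is again 12, 24 or 60. Orders 12 and 24
    cannot grow, because the closure keeps the orbit of size four or six and has
    stabilizers of order at most five; order 60 is already the largest. *)
Lemma clos6_finite_primitive K : cone_group K -> primitive K ->
  finite_mod_scalars K -> forall A, clos 6 K A -> K A.
Proof.
move=> gK prK finK; have [[Ku _ _ _] _] := gK.
have KX A : K A -> clos 6 K A by exact: sub_clos.
have [N [ordK Ncases _ Norb]] := finite_primitive_orbits charC gK prK finK.
have N84 : (N < 84)%N by move: Ncases; rewrite !inE => /or3P[]/eqP->.
have [/(clos6_not_full Ku ordK N84)//|finX] := clos_primitive_dichotomy 6 gK prK.
have gX := cone_group_clos 6 gK; have prX := primitive_sub KX prK.
have [N' [ordX N'cases N'orb _]] := finite_primitive_orbits charC gX prX finX.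
have [NN' eqKX] := projective_order_sub KX gK (@clos_unit _ _ 6 K) ordK ordX.
apply: eqKX.
have small r : (r <= 6)%N -> (N, r) \in [:: (12, 4); (24, 6)]%N -> (N' <= 5 * r)%N.
  move=> r6 /Norb[O [p [rE Oinv [A [KA nscA Ap]] pO]]]; rewrite -rE in r6 *.
  apply: (N'orb O p) => //; first by exists A; split=> //; exact: KX.
  exact: mobius_invariant_clos.
move: Ncases N'cases; rewrite !inE => /or3P[] /eqP NE /or3P[] /eqP N'E;
  rewrite NE N'E //; (have := small 4 isT; have := small 6 isT);
  by rewrite NE N'E /= => h6 h4; first [have := h4 isT | have := h6 isT].
Qed.

Lemma general_linear_bounded : bounded_by 6 [set A : 'M[C]_2 | A \in unitmx].
Proof. by apply: (@bounded_by_functions _ _ [::]) => // A; split=> [|[]]. Qed.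

(** When [G] is infinite modulo scalars, its closure in any degree is so too, hence is
    the whole general linear group. *)
Lemma primitive_envelope G : algebraic_group G -> primitive G ->
  has_bounded_envelope G.
Proof.
move=> /algebraic_groupP[cG gG] prG; have gK := cone_group_cone gG.
have prK : primitive (cone G) by apply: primitive_sub prG => A; exact: sub_cone.
have tZ := scalar_torus_torus C; have [[Ku K1 KM KV] cK] := gK.
have coneTG A : cone G A -> exists2 t, scalar_torus t & exists2 g, G g & A = t *m g.
  move=> [c c0 [g Gg ->]]; exists c%:M; first by exists c.
  by exists g => //; rewrite mul_scalar_mx.
have [finK|infK] := pselect (finite_mod_scalars (cone G)).
  have clK := clos6_finite_primitive gK prK finK.
  apply: (@bounded_envelope_intro C G (cone G) _ tZ) => //.
  - have -> : cone G = clos 6 (cone G).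
      by apply/seteqP; split=> A; [exact: sub_clos | exact: clK].
    exact: clos_bounded.
  - by move=> A [c c0 ->]; exact: cK.
  - exact: sub_cone.
have fullK : full (cone G).
  apply: cone_full_of_full_clos => // d.
  have [//|finX] := clos_primitive_dichotomy d gK prK.
  by case: infK; apply: finite_mod_scalars_sub finX => A; exact: sub_clos.
apply: (@bounded_envelope_intro C G [set A | A \in unitmx] _ tZ) => //.
- split=> [//||A B|A]; rewrite /= ?unitmx1 ?unitmx_inv //.
  by rewrite unitmx_mul => -> ->.
- exact: general_linear_bounded.
- by move=> A [c c0 ->]; apply/Ku/cK.
- by move=> A GA; exact/Ku/sub_cone.
- by move=> A /fullK; exact: coneTG.
Qed.

End PrimitiveEnvelope.

Theorem theorem3p2 (C : closedFieldType) (charC : [pchar C]%R =i pred0)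
    (G : set 'M[C]_2) (algG : algebraic_group G) :
  exists H : set 'M[C]_2, toric_envelope H G /\ bounded_by 6 H.
Proof.
have [prG|nprG] := pselect (primitive G); first exact: primitive_envelope.
exact: imprimitive_envelope.
Qed.
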